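(* Let $\mathcal S$ be a primitive, stone substitution rule on $\mathbb R^d$ with $\ell$ colors and scaling constant $\lambda>1$, let $A:\mathbb R^d\to\mathbb C^{\ell\times\ell}$ be its normalized Fourier matrix and $A^{(N)}(\xi)=A(\lambda^{-N+1}\xi)A(\lambda^{-N+2}\xi)\cdots A(\xi)$ its Fourier cocycle. Let $\chi_1>\dots>\chi_l$ be the distinct values of $\{\log|\mu| : \mu\in\operatorname{Spec}A(0),\ \mu\ne0\}$, let $\chi_{l+1}=-\infty$, and let $E_j:=\bigoplus\{E_\mu : \mu\in\operatorname{Spec}A(0),\ \log|\mu|=\chi_j\}$ for $j\in[l+1]$, where $E_\mu$ is the generalized eigenspace of $A(0)$ for $\mu$. Let $P_j:\mathbb C^\ell\to\mathbb C^\ell$, $j\in[l+1]$, be the uniquely determined idempotent operators given by the decomposition $\mathbb C^\ell=\bigoplus_{j}E_j$, so that $\operatorname{Im}P_j=E_j$ and $\sum_{j=1}^{l+1}P_j=I$. Then there exists $R>0$ such that for all $\xi\in B_R$ there exist linear maps $P_j(\xi):\mathbb C^\ell\to\mathbb C^\ell$, $j\in[l+1]$, with $\sum_{j=1}^{l+1}P_j(\xi)=I$ such that for all $x\in\mathbb C^\ell$ the following hold as $N\to\infty$: (i) for all $j\in[l+1]$: $\ \|A^{(N)}(\xi)P_j(\xi)x\|\approx e^{\chi_jN}\|P_j(\xi)x\|$; (ii) for all $j,k\in[l+1]$: $\ \|P_kA^{(N)}(\xi)P_j(\xi)x\|\lesssim\lambda^{-N}\|A^{(N)}(\xi)P_j(\xi)x\|$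 if $j>k$, and $\ \|P_kA^{(N)}(\xi)P_j(\xi)x\|\lessapprox\max(e^{\chi_k-\chi_j},\lambda^{-1})^N\|A^{(N)}(\xi)P_j(\xi)x\|$ if $j<k$.
   Context: $[n]=\{1,\dots,n\}$; $B_R$ is the closed ball of radius $R$ around $0$ in $\mathbb R^d$; $\|\cdot\|$ is any norm on $\mathbb C^\ell$; $\log0=-\infty$, $e^{-\infty}=0$. A substitution rule on $\mathbb R^d$ with $\ell$ colors is a pair $\mathcal S=(\lambda,\Delta)$ with $\lambda>1$ and $\Delta=(\Delta_{jk})_{j,k\in[\ell]}$, each $\Delta_{jk}$ a finite subset of $\mathbb R^d$. With $(M_{\mathrm{full}})_{jk}=\#\Delta_{jk}$, it is primitive if some power of $M_{\mathrm{full}}$ has all entries positive. It is stone if it is primitive and there exist compact sets $\tau_1,\dots,\tau_\ell\subset\mathbb R^d$ of positive Lebesgue measure with $\mathbf 1_{\lambda\tau_j}=\sum_{k}\sum_{x\in\Delta_{kj}}\mathbf 1_{x+\tau_k}$ almost everywhere for all $j$. The normalized Fourier matrix has entries $A_{jk}(\xi)=\lambda^{-d}\sum_{x\in\Delta_{jk}}e^{2\pi i\langle x,\xi\rangle}$; thus $A(0)=\lambda^{-d}M_{\mathrm{full}}$. For $f,g:\mathbb N\to\mathbb R_{\ge0}$, as $N\to\infty$: $f\lesssim g$ means there are $C>0$, $N_0$ with $f(N)\le Cg(N)$ for $N\ge N_0$; $f\lessapprox g$ means $\limsup_N\frac1N\log f(N)\le\limsup_N\frac1N\log g(N)$; $f\gtrapprox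 g$ means $\liminf_N\frac1N\log f(N)\ge\liminf_N\frac1N\log g(N)$; $f\approx g$ means both $f\lessapprox g$ and $f\gtrapprox g$. *)

(* Defs.v *)
From mathcomp Require Import all_boot all_order all_algebra finmap.
From mathcomp Require Import all_classical all_reals all_analysis.
From mathcomp Require Import complex.

Set Implicit Arguments.
Unset Strict Implicit.
Unset Printing Implicit Defensive.

Import Order.TTheory GRing.Theory Num.Theory.
Import numFieldNormedType.Exports.

Local Open Scope classical_set_scope.
Local Open Scope ring_scope.
Local Open Scope complex_scope.

Section EuclideanSpace.
Context {R : realType} {d : nat}.
Implicit Types (x y a b : 'rV[R]_d) (X : set 'rV[R]_d).

Definition dotrv x y : R := \sum_(i < d) x 0 i * y 0 i.

Definition euclid x : R := Num.sqrt (dotrv x x).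

Definition cbox a b : set 'rV[R]_d :=
  [set x | forall i, a 0 i <= x 0 i <= b 0 i].

Definition cbox_vol a b : R := \prod_(i < d) (b 0 i - a 0 i).

(* Lebesgue outer measure on R^d (d >= 1), as the infimum over countable covers
   by closed boxes.  It agrees with Lebesgue measure on measurable sets, in
   particular on compact sets, and its null sets are the Lebesgue null sets. *)
Definition lebesgue_outer X : \bar R :=
  ereal_inf [set s | exists a b : nat -> 'rV[R]_d,
    [/\ forall n i, a n 0 i <= b n 0 i,
        X `<=` \bigcup_n cbox (a n) (b n)
      & s = (\sum_(0 <= n <oo) (cbox_vol (a n) (b n))%:E)%E]].

Definition lebesgue_ae (Q : 'rV[R]_d -> Prop) : Prop :=
  lebesgue_outer [set x | ~ Q x] = 0%E.

End EuclideanSpace.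

Record subst_rule (R : realType) (d ell : nat) := SubstRule {
  scaling : R;
  scaling_gt1 : 1 < scaling;
  digits : 'I_ell -> 'I_ell -> {fset 'rV[R]_d}
}.

Section SubstitutionRule.
Context {R : realType} {d ell : nat} (S : subst_rule R d ell).
Local Notation lambda := (scaling S).

Definition full_mx : 'M[nat]_ell := \matrix_(j, k) #|` digits S j k|.

(* The power is required to be at least 1: for a single colour the zeroth power
   would make even the rule without digits primitive. *)
Definition primitive : Prop :=
  exists2 m : nat, (0 < m)%N & forall j k, (0 < (full_mx ^+ m) j k)%N.

Definition stone : Prop :=
  primitive /\
  exists tau : 'I_ell -> set 'rV[R]_d,
    (forall j, compact (tau j) /\ (0 < lebesgue_outer (tau j))%E) /\
    (forall j, lebesgue_ae (fun y =>
       \1_[set lambda *: t | t in tau j] y =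
       \sum_(k < ell) \sum_(x <- digits S k j) \1_[set x + t | t in tau k] y :> R)).

(* exp (i t) *)
Definition cis (t : R) : R[i] := (cos t +i* sin t)%C.

Definition fourier_mx (xi : 'rV[R]_d) : 'M[R[i]]_ell :=
  \matrix_(j, k) ((lambda ^- d)%:C *
                  \sum_(x <- digits S j k) cis (2 * pi * dotrv x xi)).

(* The factors run from A(lambda^(1-N) xi) on the left to A(xi) on the right. *)
Definition cocycle (N : nat) (xi : 'rV[R]_d) : 'M[R[i]]_ell :=
  \prod_(i < N) fourier_mx (lambda ^- (N - i.+1) *: xi).

End SubstitutionRule.

Record is_norm (R : realType) (ell : nat) (nrm : 'cV[R[i]]_ell -> R) : Prop :=
  IsNorm {
    norm_triangle : forall x y, nrm (x + y) <= nrm x + nrm y;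
    norm_scale : forall (a : R[i]) x, nrm (a *: x) = Normc.normc a * nrm x;
    norm_definite : forall x, nrm x = 0 -> x = 0
  }.

Section Spectrum.
Context {R : realType} {ell : nat} (A : 'M[R[i]]_ell).

(* The roots of the characteristic polynomial, without multiplicity. *)
Definition spectrum : seq R[i] :=
  undup (sval (closed_field_poly_normal (char_poly A))).

(* log |mu|, with value -oo at mu = 0 *)
Definition logmod (mu : R[i]) : \bar R := lne (Normc.normc mu)%:E.

(* chi 0 > ... > chi (n - 1) enumerates the log |mu| for mu a nonzero
   eigenvalue of A, and chi n = -oo. *)
Definition log_moduli (n : nat) (chi : 'I_n.+1 -> \bar R) : Prop :=
  [/\ forall j k : 'I_n.+1, (j < k)%N -> (chi k < chi j)%E,
      chi ord_max = -oo%E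
    & [set chi j | j in [set j : 'I_n.+1 | j != ord_max]] =
      [set logmod mu | mu in [set mu | mu \in spectrum /\ mu != 0]]].

(* The sum of the generalized eigenspaces of A for the eigenvalues mu with
   log |mu| = c.  MathComp subspaces are row spaces, so a column vector v lies
   in this space when v^T lies in the row space of [modulus_space c]; hence the
   transpose of A. *)
Definition modulus_space (c : \bar R) : 'M[R[i]]_ell :=
  (\sum_(mu <- spectrum | logmod mu == c) geigenspace A^T mu)%MS.

(* (P j)^T has as row space the column space, i.e. the image, of P j. *)
Definition spectral_projections (n : nat) (chi : 'I_n.+1 -> \bar R)
    (P : 'I_n.+1 -> 'M[R[i]]_ell) : Prop :=
  [/\ forall j, P j *m P j = P j,
      forall j, ((P j)^T :=: modulus_space (chi j))%MS
    & \sum_j P j = 1%:M].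

End Spectrum.

Section Asymptotics.
Context {R : realType}.
Implicit Types f g : nat -> R.

Definition lesssim f g : Prop :=
  exists2 C : R, 0 < C & exists N0 : nat, forall N, (N0 <= N)%N -> f N <= C * g N.

(* N^-1 log (f N), with log 0 = -oo *)
Definition lograte f : nat -> \bar R :=
  fun N => ((N%:R^-1)%:E * lne (f N)%:E)%E.

Definition lessapprox f g : Prop :=
  (limn_esup (lograte f) <= limn_esup (lograte g))%E.

Definition gtrapprox f g : Prop :=
  (limn_einf (lograte g) <= limn_einf (lograte f))%E.

Definition expapprox f g : Prop := lessapprox f g /\ gtrapprox f g.

(* The exponential of an exponent in [-oo, +oo[, with exp (-oo) = 0 *)
Definition expE (c : \bar R) : R := fine (expeR c).

End Asymptotics.

(* Main.v *)
Require Import Defs.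
From mathcomp Require Import all_boot all_order all_algebra finmap.
From mathcomp Require Import all_classical all_reals all_analysis.
From mathcomp Require Import complex.
From mathcomp Require Import ring lra.

Import Order.TTheory GRing.Theory Num.Theory.

Local Open Scope ring_scope.
Import numFieldNormedType.Exports.

(** At time [N] the cocycle applies [A(lambda^-N xi)], which differs from
    [A(0)] by [O(lambda^-N)]. So an orbit [x_N = A^(N)(xi) y] satisfies
    [|x_(N+1) - A(0) x_N| <= D lambda^-N |x_N|], and the theorem is a
    quantitative form of Perron's theorem on linear difference equations with
    asymptotically constant coefficients.

    Decompose [x_N] along the generalized eigenspaces of [A(0)] and measure each
    component with a seminorm for which [A(0)] expands by [|mu|] up to a small
    [e] (lemmas [adapted_le] and [adapted_ge]).  Fix a gap [s < r] between two
    consecutive moduli, let [S_N] be the total size of the components with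
    [|mu| > r] and [T_N] that of the others. Up to the error,
    [S_(N+1) >= r S_N] and [T_(N+1) <= s T_N].  Once the error is smaller than
    the gap, the cone [S > T] is invariant.  Either the orbit enters it, and
    grows at least like [r^N]; or [S <= T] forever, the orbit is at most of order
    [s^N], and since [S] would have to escape at rate [r] if it were not fed by
    [T], it is slaved to the error: [S_N = O(lambda^-N T_N)].  This is
    [fast_slow_dichotomy], transported to vectors in [orbit_dichotomy].

    For each [j] the vectors [y] whose orbit is in the second case at the gap
    just above the modulus [r_j = exp chi_j] form a subspace [slow j], and these
    subspaces decrease with [j]. Choose [Q_j] summing to the identity with values
    in [slow j] and meeting [slow (j+1)] only in [0] ([flag_splitting]).  A
    nonzero [y = Q_j x] is then in the second case at every gap above [r_j] and
    in the first case at every gap below it, hence its orbit has exponential rate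
    exactly [chi_j], which is (i), and its components faster than [r_j] are
    [O(lambda^-N)] relative to the orbit, which is (ii) for [k < j].  For [j < k]
    the component along [E_k] obeys [u_(N+1) <= (r_k + e) u_N + K lambda^-N |x_N|]
    with [|x_N|] of order [r_j^N], so it grows no faster than
    [max(r_k, r_j / lambda)^N] ([component_growth]).

    The eigenvalue [0] is covered by the same argument with [r_j = 0]: being in
    the second case for every positive [s] means that the rate is [-oo]. *)

(** * Almost geometric sequences *)

Section Sequences.
Set Implicit Arguments.
Unset Strict Implicit.
Local Open Scope classical_set_scope.
Local Open Scope ring_scope.

Lemma geometric_small (R : realType) (l C e : R) : 1 < l -> 0 <= C -> 0 < e ->
  exists N0 : nat, forall n, (N0 <= n)%N -> C * l ^- n <= e.
Proof.
move=> l1 C0 e0; have l0 : 0 < l by apply: lt_trans l1.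
have li1 : `|l^-1| < 1 by rewrite gtr0_norm ?invr_gt0// invf_lt1.
have h := @cvg_geometric R C l^-1 li1.
have /cvgrPdist_le/(_ e e0)[N0 _ hN] := h.
exists N0 => n Nn; have := hN n Nn; rewrite /= sub0r normrN exprVn.
by apply: le_trans; apply: ler_norm.
Qed.

Lemma geometric_growth (R : realType) (u : nat -> R) (r : R) (n0 : nat) :
  0 < r -> 0 < u n0 -> (forall n, (n0 <= n)%N -> r * u n <= u n.+1) ->
  exists2 c : R, 0 < c & forall n, (n0 <= n)%N -> c * r ^+ n <= u n.
Proof.
move=> r0 u0 step; exists (u n0 * r ^- n0).
  by rewrite mulr_gt0 ?invr_gt0 ?exprn_gt0.
elim=> [|n IH]; first by rewrite leqn0 => /eqP ->; rewrite expr0 invr1 !mulr1.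
rewrite leq_eqVlt => /orP[/eqP <-|]; first by rewrite mulfVK ?expf_neq0 ?gt_eqF.
rewrite ltnS => n0n; apply: le_trans (step n n0n); rewrite exprS mulrCA.
by rewrite ler_pM2l// IH.
Qed.

Lemma geometric_decay (R : realType) (u : nat -> R) (r K t : R) (n0 : nat) :
  0 <= r -> r < t -> 0 <= K -> 
  (forall n, (n0 <= n)%N -> u n.+1 <= r * u n + K * t ^+ n) ->
  exists2 C : R, 0 < C & forall n, (n0 <= n)%N -> u n <= C * t ^+ n.
Proof.
move=> r0 rt K0 step; have t0 : 0 < t by apply: le_lt_trans rt.
pose C1 := `|u n0| * t ^- n0 + K / (t - r) + 1.
have a0 : 0 <= `|u n0| * t ^- n0.
  by rewrite mulr_ge0 ?normr_ge0 ?invr_ge0 ?exprn_ge0 // ?ltW.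
have b0 : 0 <= K / (t - r) by rewrite divr_ge0 ?subr_ge0 // ?ltW.
have C10 : 0 < C1 by rewrite /C1; lra.
have hK : K <= C1 * (t - r).
  by rewrite -ler_pdivrMr ?subr_gt0// /C1; lra.
exists C1 => //.
have base : u n0 <= C1 * t ^+ n0.
  apply: le_trans (ler_norm _) _; rewrite -ler_pdivrMr ?exprn_gt0// /C1; lra.
elim=> [|n IH]; first by rewrite leqn0 => /eqP n00; rewrite -n00.
rewrite leq_eqVlt => /orP[/eqP <- //|]; rewrite ltnS => n0n.
apply: le_trans (step n n0n) _.
have := IH n0n; have := exprn_gt0 n t0; rewrite exprS; set w := t ^+ n => w0 un.
have h1 : r * u n <= r * (C1 * w) by rewrite ler_wpM2l.
have h2 : K * w <= C1 * (t - r) * w by rewrite ler_pM2r.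
lra.
Qed.

(** Read backwards in time, [S] contracts: [S n] is bounded by
    [r^-1 (S (n+1) + error)], while [T (n+1) <= s T n] with [s < r].  So a bound
    on [S / T] at time [n + m] improves by the factor [(s / r) ^+ m] on its way
    back to time [n], and only the errors accumulated in between, a geometric
    series of size [l ^- n], survive as [m] tends to infinity. *)
Lemma slaved_fast_part (R : realType) (S T : nat -> R) (l C r s : R) (n0 : nat) :
  1 < l -> 0 <= C -> 0 <= s -> s < r ->
  (forall n, 0 <= T n) ->
  (forall n, (n0 <= n)%N -> r * S n <= S n.+1 + C * l ^- n * T n) ->
  (forall n, (n0 <= n)%N -> T n.+1 <= s * T n) ->
  (forall n, (n0 <= n)%N -> S n <= T n) ->
  forall n, (n0 <= n)%N -> S n <= C / (r - s) * l ^- n * T n.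
Proof.
move=> l1 C0 s0 sr T0 hS hT ST; have r0 : 0 < r by apply: le_lt_trans sr.
have l0 : 0 < l by apply: lt_trans l1.
pose K := C / (r - s); have K0 : 0 <= K by rewrite divr_ge0 ?subr_ge0 // ?ltW.
have KC : K * (r - s) = C by rewrite /K divfK// subr_eq0 gt_eqF.
  (* The constant K is the fixed point of the backward step:
     [s K + C = r K]. *)
have main m n : (n0 <= n)%N -> S n <= ((s / r) ^+ m + K * l ^- n) * T n.
  elim: m n => [|m IH] n n0n.
    rewrite expr0 (le_trans (ST n n0n))//; rewrite -[leLHS]mul1r ler_wpM2r// lerDl.
    by apply: mulr_ge0; rewrite ?K0 ?invr_ge0 ?exprn_ge0 // ltW.
  rewrite -(ler_pM2l r0); apply: le_trans (hS n n0n) _.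
  have {IH} := IH n.+1 (leqW n0n).
  set q := (s / r) ^+ m; have q0 : 0 <= q by rewrite exprn_ge0 ?divr_ge0 // ?ltW.
  have -> : (s / r) ^+ m.+1 = s / r * q by rewrite exprS.
  have -> (w t : R) : r * ((s / r * q + w) * t) = (s * q + r * w) * t.
    by field; rewrite gt_eqF.
  have w0 : 0 < l ^- n by rewrite invr_gt0 exprn_gt0.
  have ww : l ^- n.+1 <= l ^- n.
    by rewrite lef_pV2 ?posrE ?exprn_gt0// ler_eXn2l// ltW.
  set w := l ^- n in w0 ww *; set w1 := l ^- n.+1 in ww *.
  move=> IH.
  have h1 : (q + K * w1) * T n.+1 <= (q + K * w) * (s * T n).
    apply: ler_pM => //; last exact: hT.
      by rewrite addr_ge0// mulr_ge0// /w1 invr_ge0 exprn_ge0 ?ltW.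
    by rewrite lerD2l ler_wpM2l.
  apply: le_trans (lerD (le_trans IH h1) (lexx _)) _.
  rewrite -KC le_eqVlt; apply/orP; left; apply/eqP; ring.
move=> n n0n; have sr1 : `|s / r| < 1.
  by rewrite ger0_norm ?divr_ge0 // ?ltW// ltr_pdivrMr// mul1r.
have : (fun m => ((s / r) ^+ m + K * l ^- n) * T n) @ \oo -->
       (0 + K * l ^- n) * T n.
  by apply: cvgMl; apply: cvgD; [exact: cvg_expr|exact: cvg_cst].
rewrite add0r => cv; apply: (@ler_cvg_to _ \oo _ _ (fun=> S n) _ _ _ (cvg_cst _) cv).
by apply: nearW => m; exact: main.
Qed.

(** The cone argument.  After the time at which the error is below half of both
    margins [s' - s] and [r - r'], the condition [T < S] propagates forward, so
    it either holds from some time on or never holds again. *)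
Lemma fast_slow_dichotomy (R : realType) (S T : nat -> R) (l C r s r' s' : R) :
  1 < l -> 0 <= C -> 0 <= s -> s < s' -> s' < r' -> r' < r ->
  (forall n, 0 <= S n) -> (forall n, 0 <= T n) ->
  (forall n, r * S n <= S n.+1 + C * l ^- n * (S n + T n)) ->
  (forall n, T n.+1 <= s * T n + C * l ^- n * (S n + T n)) ->
  (exists2 c : R, 0 < c & exists n0 : nat,
     forall n, (n0 <= n)%N -> c * r' ^+ n <= S n) \/
  (exists2 K : R, 0 < K & exists n0 : nat, forall n, (n0 <= n)%N ->
     T n <= K * s' ^+ n /\ S n <= K * l ^- n * T n).
Proof.
move=> l1 C0 s0 ss' sr' rr' S0 T0 hS hT.
have l0 : 0 < l by apply: lt_trans l1.
have [s'0 r'0] : 0 < s' /\ 0 < r' by split; lra.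
have [n1 hn1] := @geometric_small R l C (Num.min ((s' - s) / 2) ((r - r') / 2))
  l1 C0 ltac:(rewrite lt_min; apply/andP; split; lra).
have {}hn1 n : (n1 <= n)%N -> 0 <= C * l ^- n /\
    C * l ^- n <= (s' - s) / 2 /\ C * l ^- n <= (r - r') / 2.
  move=> /hn1; rewrite le_min => /andP[? ?]; split=> //.
  by rewrite mulr_ge0 // invr_ge0 exprn_ge0 // ltW.
have [[n0 [n10 TS]]|noTS] := pselect (exists n0, (n1 <= n0)%N /\ T n0 < S n0).
  left.
  have pers n : (n0 <= n)%N -> T n < S n.
    elim: n => [|n IH]; first by rewrite leqn0 => /eqP n00; rewrite -n00.
    rewrite leq_eqVlt => /orP[/eqP <- //|]; rewrite ltnS => n0n.
    have {}IH := IH n0n; have := hn1 n (leq_trans n10 n0n); have := hS n.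
    have := hT n; have := T0 n; have := S0 n.
    set b := C * _ => Sn Tn hTn hSn [b0 [b1 b2]].
    have h1 : b * (S n + T n) <= b * (2 * S n) by rewrite ler_wpM2l//; lra.
    have h2 : b * (2 * S n) <= (s' - s) * S n by rewrite mulrA ler_wpM2r//; lra.
    have h3 : b * (2 * S n) <= (r - r') * S n by rewrite mulrA ler_wpM2r//; lra.
    have h4 : s * T n <= s * S n by rewrite ler_wpM2l// ltW.
    have h5 : s' * S n < r' * S n by rewrite ltr_pM2r//; lra.
    lra.
  have [|c c0 hc] := @geometric_growth R S r' n0 r'0 (le_lt_trans (T0 n0) TS).
    move=> n n0n; have := hn1 n (leq_trans n10 n0n); have := hS n.
    have := pers n n0n; have := T0 n; have := S0 n.
    set b := C * _ => Sn Tn TSn hSn [b0 [b1 b2]].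
    have h1 : b * (S n + T n) <= b * (2 * S n) by rewrite ler_wpM2l//; lra.
    have h3 : b * (2 * S n) <= (r - r') * S n by rewrite mulrA ler_wpM2r//; lra.
    lra.
  by exists c => //; exists n0.
right.
have ST n : (n1 <= n)%N -> S n <= T n.
  by move=> n1n; rewrite leNgt; apply/negP => ?; apply: noTS; exists n.
have step n : (n1 <= n)%N -> T n.+1 <= s' * T n.
  move=> n1n; have := hn1 n n1n; have := hT n; have := ST n n1n; have := T0 n.
  set b := C * _ => Tn STn hTn [b0 [b1 b2]].
  have h1 : b * (S n + T n) <= b * (2 * T n) by rewrite ler_wpM2l//; lra.
  have h3 : b * (2 * T n) <= (s' - s) * T n by rewrite mulrA ler_wpM2r//; lra.
  lra.
have stepS n : (n1 <= n)%N -> r * S n <= S n.+1 + (2 * C) * l ^- n * T n.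
  move=> n1n; apply: le_trans (hS n) _; rewrite lerD2l.
  have -> : 2 * C * l ^- n * T n = C * l ^- n * (2 * T n) by ring.
  have [b0 _] := hn1 n n1n; rewrite ler_wpM2l//.
  by have := ST n n1n; lra.
have C20 : 0 <= 2 * C by lra.
have hK := @slaved_fast_part R S T l (2 * C) r s' n1 l1 C20 (ltW s'0)
   (lt_trans sr' rr') T0 stepS step ST.
have Kp : 0 <= 2 * C / (r - s') by rewrite divr_ge0 // subr_ge0; lra.
exists (2 * C / (r - s') + T n1 * s' ^- n1 + 1).
  have : 0 <= T n1 * s' ^- n1 by rewrite mulr_ge0// invr_ge0 exprn_ge0// ltW.
  lra.
have Tp : 0 <= T n1 * s' ^- n1 by rewrite mulr_ge0// invr_ge0 exprn_ge0// ltW.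
exists n1 => n n1n; split.
  have hT1 : T n <= T n1 * s' ^- n1 * s' ^+ n.
    move: n n1n; elim=> [|n IH].
      by rewrite leqn0 => /eqP ->; rewrite expr0 invr1 !mulr1.
    rewrite leq_eqVlt => /orP[/eqP <-|]; first by rewrite mulfVK ?expf_neq0 ?gt_eqF.
    rewrite ltnS => n1n; apply: le_trans (step n n1n) _; rewrite exprS [leRHS]mulrCA.
    by rewrite ler_pM2l// IH.
  by apply: le_trans hT1 _; rewrite ler_wpM2r ?exprn_ge0 ?ltW//; lra.
apply: le_trans (hK n n1n) _; rewrite ler_wpM2r// ler_wpM2r ?invr_ge0 ?exprn_ge0 ?ltW//.
lra.
Qed.

End Sequences.

(** * Exponential rates *)

Section Rates.
Set Implicit Arguments.
Unset Strict Implicit.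
Local Open Scope classical_set_scope.
Local Open Scope ring_scope.

Lemma lne_le (R : realType) (x y : R) : x <= y -> (lne x%:E <= lne y%:E)%E.
Proof.
move=> xy /=; have [_|x0] := leP x 0; first by rewrite leNye.
rewrite (leNgt y) (lt_le_trans x0 xy)/=.
by rewrite lee_fin ler_ln ?posrE// (lt_le_trans x0).
Qed.

Lemma expeR_lne (R : realType) (t : R) : 0 <= t -> expeR (lne t%:E) = t%:E.
Proof. by move=> t0; rewrite lneK ?in_itv/= ?lee_fin ?t0 ?leey. Qed.

Lemma le_lograte (R : realType) (f g : nat -> R) N :
  f N <= g N -> (lograte f N <= lograte g N)%E.
Proof.
move=> fg; have /lee_wpmul2l : (0 <= (N%:R^-1)%:E :> \bar R)%E by rewrite lee_fin.
by apply; exact: lne_le.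
Qed.

Lemma le_limn_esup (R : realType) (u v : nat -> \bar R) (n0 : nat) :
  (forall n, (n0 <= n)%N -> (u n <= v n)%E) -> (limn_esup u <= limn_esup v)%E.
Proof.
move=> uv; rewrite !limn_esup_lim; apply: lee_lim; try exact: is_cvg_esups.
exists n0 => // n /= n0n; apply: ge_ereal_sup => _ [k /= nk <-].
apply: le_trans (uv k (leq_trans n0n nk)) _.
by apply: ereal_sup_ubound; exists k.
Qed.

Lemma le_limn_einf (R : realType) (u v : nat -> \bar R) (n0 : nat) :
  (forall n, (n0 <= n)%N -> (u n <= v n)%E) -> (limn_einf u <= limn_einf v)%E.
Proof.
move=> uv; rewrite /limn_einf leeN2; apply: (@le_limn_esup _ _ _ n0) => n n0n.
by rewrite leeN2 uv.
Qed.

(** The constant [K] disappears in the limit, since [ln K / N] tends to [0]. *)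
Lemma lograte_geometric (R : realType) (K t : R) : 0 < K -> 0 < t ->
  (lograte (fun N => K * t ^+ N) @ \oo --> lne t%:E)%classic.
Proof.
move=> K0 t0; rewrite lne_EFin//.
have h : (fun n : nat => (n.+1%:R^-1 * ln K + ln t)%:E) @ \oo --> (0 * ln K + ln t)%:E.
  apply: cvg_EFin; first exact: nearW.
  by apply: cvgD; [apply: cvgMl; exact: cvg_harmonic|exact: cvg_cst].
rewrite mul0r add0r in h; rewrite -cvg_shiftS; apply: cvg_trans h.
apply: near_eq_cvg; apply: nearW => n /=.
rewrite /lograte lne_EFin ?mulr_gt0 ?exprn_gt0// lnM ?posrE ?exprn_gt0// lnXn//.
by rewrite -EFinM -[ln t *+ n.+1]mulr_natl mulrDr mulKf.
Qed.

(** Comparison with every geometric sequence of ratio [t > r], rather than with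
    [r ^+ N] itself, absorbs subexponential factors; it also makes sense at
    [r = 0], where it says that [f] decays superexponentially. *)
Lemma lograte_le (R : realType) (f : nat -> R) (r : R) : 0 <= r ->
  (forall t, r < t -> lesssim f (fun N => t ^+ N)) ->
  (limn_esup (lograte f) <= lne r%:E)%E.
Proof.
move=> r0 hf; rewrite -lee_expeR expeR_lne//.
apply/lee_addgt0Pr => e e0; have re : r < r + e by rewrite ltrDl.
have t0 : 0 < r + e by apply: le_lt_trans re.
have [K K0 [n0 hK]] := hf _ re.
rewrite -EFinD -(expeR_lne (ltW t0)) lee_expeR.
have [_ <-] := cvg_limn_einf_sup (lograte_geometric K0 t0).
by apply: (@le_limn_esup _ _ _ n0) => n n0n; apply: le_lograte; exact: hK.
Qed.

Lemma lograte_ge (R : realType) (f : nat -> R) (r : R) : 0 <= r ->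
  (forall t, 0 < t -> t < r -> lesssim (fun N => t ^+ N) f) ->
  (lne r%:E <= limn_einf (lograte f))%E.
Proof.
move=> r0 hf; rewrite -lee_expeR expeR_lne//.
apply/lee_subgt0Pr => e e0; have re : r - e < r by rewrite ltrBlDr ltrDl.
have [t0|t0] := leP (r - e) 0.
  by rewrite -EFinB (@le_trans _ _ 0%E) ?lee_fin// expeR_ge0.
have [K K0 [n0 hK]] := hf _ t0 re.
rewrite -EFinB -(expeR_lne (ltW t0)) lee_expeR.
have Ki0 : 0 < K^-1 by rewrite invr_gt0.
have [<- _] := cvg_limn_einf_sup (lograte_geometric Ki0 t0).
apply: (@le_limn_einf _ _ _ n0) => n n0n; apply: le_lograte.
by rewrite ler_pdivrMl// hK.
Qed.

Context {R : realType}.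

Lemma lograte_exact (f : nat -> R) (r : R) : 0 <= r ->
  (forall t, r < t -> lesssim f (fun N => t ^+ N)) ->
  (forall t, 0 < t -> t < r -> lesssim (fun N => t ^+ N) f) ->
  limn_esup (lograte f) = lne r%:E /\ limn_einf (lograte f) = lne r%:E.
Proof.
move=> r0 /(lograte_le r0) up /(lograte_ge r0) low.
have io := limn_einf_sup (lograte f).
split; apply/eqP; rewrite eq_le.
  by rewrite up (le_trans low io).
by rewrite low (le_trans io up).
Qed.

Lemma lesssim_trans (f g h : nat -> R) :
  lesssim f g -> lesssim g h -> lesssim f h.
Proof.
move=> [K K0 [n0 hK]] [L L0 [n1 hL]]; exists (K * L); first exact: mulr_gt0.
exists (maxn n0 n1) => N; rewrite geq_max => /andP[/hK h1 /hL h2].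
by apply: le_trans h1 _; rewrite -mulrA ler_pM2l.
Qed.

Lemma lesssim_all (f g : nat -> R) (K : R) : 0 < K ->
  (forall N, f N <= K * g N) -> lesssim f g.
Proof. by move=> K0 h; exists K => //; exists 0%N => N _. Qed.

Lemma lesssim_sum (I : finType) (Q : pred I) (f : I -> nat -> R) (g : nat -> R) :
  (forall N, 0 <= g N) ->
  (forall i, Q i -> lesssim (f i) g) ->
  lesssim (fun N => \sum_(i | Q i) f i N) g.
Proof.
move=> g0 h.
suff : exists2 K : R, 0 < K & exists n0, forall N, (n0 <= N)%N ->
  \sum_(i | Q i) f i N <= K * g N by [].
elim: (index_enum I) => [|i s [K K0 [n0 hK]]].
  by exists 1 => //; exists 0%N => N _; rewrite big_nil mul1r.
case Qi: (Q i); last by exists K => //; exists n0 => N /hK; rewrite big_cons Qi.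
have [L L0 [n1 hL]] := h i Qi; exists (L + K); first exact: addr_gt0.
exists (maxn n0 n1) => N; rewrite geq_max => /andP[/hK h1 /hL h2].
by rewrite big_cons Qi mulrDl lerD.
Qed.

Lemma lesssim_mull (f g c : nat -> R) : (forall N, 0 <= c N) ->
  lesssim f g -> lesssim (fun N => c N * f N) (fun N => c N * g N).
Proof.
move=> c0 [K K0 [n0 hK]]; exists K => //; exists n0 => N /hK h.
by rewrite mulrCA ler_wpM2l.
Qed.

Lemma expE_lneM (r : R) (N : nat) : 0 <= r ->
  expE (lne r%:E * N%:R%:E)%E = r ^+ N.
Proof.
rewrite le_eqVlt => /orP[/eqP <-|r0].
  case: N => [|N] /=; rewrite lexx; first by rewrite mule0 /expE expeR0.
  by rewrite gt0_mulNye ?lte_fin ?ltr0n// /expE /= expr0n.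
rewrite lne_EFin// -EFinM /expE /= mulrC expRM_natl lnK//.
Qed.

Lemma expE_lneB (a b : R) : 0 <= a -> 0 < b ->
  expE (lne a%:E - lne b%:E)%E = a / b.
Proof.
move=> a0 b0; rewrite (lne_EFin b0); move: a0; rewrite le_eqVlt => /orP[/eqP <-|a0].
  by rewrite /= lexx /expE /= mul0r.
by rewrite lne_EFin// -EFinB /expE /= expRB !lnK.
Qed.

End Rates.

(** * Norms on complex matrices *)

Section Norms.
Set Implicit Arguments.
Unset Strict Implicit.
Local Open Scope classical_set_scope.
Local Open Scope ring_scope.
Context {R : realType}.

Lemma normc_ge0 (z : R[i]) : 0 <= Normc.normc z.
Proof. by case: z => a b; rewrite sqrtr_ge0. Qed.

Lemma normc_sum (I : Type) (s : seq I) (Q : pred I) (F : I -> R[i]) :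
  Normc.normc (\sum_(i <- s | Q i) F i) <= \sum_(i <- s | Q i) Normc.normc (F i).
Proof.
elim/big_ind2 : _ => [|x1 x2 y1 y2 h1 h2|//]; first by rewrite Normc.normc0.
exact: le_trans (le_normcD _ _) (lerD h1 h2).
Qed.

Lemma normc_real (x : R) : Normc.normc (x%:C)%C = `|x|.
Proof. by rewrite /Normc.normc /= expr0n addr0 sqrtr_sqr. Qed.

Lemma normc_le (a b : R) : Normc.normc (a +i* b)%C <= `|a| + `|b|.
Proof.
rewrite /Normc.normc /= -(ler_pXn2r (n := 2)) ?nnegrE ?sqrtr_ge0 ?addr_ge0//.
rewrite sqr_sqrtr ?addr_ge0 ?sqr_ge0// sqrrD !real_normK ?num_real//.
by rewrite lerD2r lerDl mulrn_wge0// mulr_ge0.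
Qed.

(** The entrywise l^1 norm is submultiplicative for products of rectangular
    matrices, so that it bounds operators and vectors at once. *)
Definition mxl1 m n (A : 'M[R[i]]_(m, n)) : R :=
  \sum_i \sum_j Normc.normc (A i j).

Lemma mxl1_ge0 m n (A : 'M[R[i]]_(m, n)) : 0 <= mxl1 A.
Proof. by do 2!apply: sumr_ge0 => ? _; exact: normc_ge0. Qed.

Lemma mxl1_0 m n : mxl1 (0 : 'M[R[i]]_(m, n)) = 0.
Proof. by apply: big1 => i _; apply: big1 => j _; rewrite mxE Normc.normc0. Qed.

Lemma mxl1D m n (A B : 'M[R[i]]_(m, n)) : mxl1 (A + B) <= mxl1 A + mxl1 B.
Proof.
rewrite /mxl1 -big_split; apply: ler_sum => i _.
by rewrite -big_split; apply: ler_sum => j _; rewrite mxE; exact: le_normcD.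
Qed.

Lemma mxl1N m n (A : 'M[R[i]]_(m, n)) : mxl1 (- A) = mxl1 A.
Proof. by do 2!apply: eq_bigr => ? _; rewrite mxE normcN. Qed.

Lemma mxl1B m n (A B : 'M[R[i]]_(m, n)) : mxl1 A - mxl1 B <= mxl1 (A + B).
Proof.
by rewrite lerBlDr -(mxl1N B); apply: le_trans (mxl1D _ _); rewrite addrK.
Qed.

Lemma mxl1Z m n a (A : 'M[R[i]]_(m, n)) : mxl1 (a *: A) = Normc.normc a * mxl1 A.
Proof.
rewrite /mxl1 mulr_sumr; apply: eq_bigr => i _; rewrite mulr_sumr.
by apply: eq_bigr => j _; rewrite mxE Normc.normcM.
Qed.

Lemma mxl1_sum m n (I : Type) (s : seq I) (Q : pred I) (F : I -> 'M[R[i]]_(m, n)) :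
  mxl1 (\sum_(i <- s | Q i) F i) <= \sum_(i <- s | Q i) mxl1 (F i).
Proof.
elim/big_ind2 : _ => [|x1 x2 y1 y2 h1 h2|//]; first by rewrite mxl1_0.
exact: le_trans (mxl1D _ _) (lerD h1 h2).
Qed.

Lemma le_mxl1 m n (A : 'M[R[i]]_(m, n)) i j : Normc.normc (A i j) <= mxl1 A.
Proof.
rewrite /mxl1 (bigD1 i)//= (bigD1 j)//= -addrA lerDl addr_ge0//.
  by apply: sumr_ge0 => *; exact: normc_ge0.
by do 2!apply: sumr_ge0 => *; exact: normc_ge0.
Qed.

Lemma mxl1M m n p (A : 'M[R[i]]_(m, n)) (B : 'M[R[i]]_(n, p)) :
  mxl1 (A *m B) <= mxl1 A * mxl1 B.
Proof.
rewrite {1 2}/mxl1 mulr_suml; apply: ler_sum => i _.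
have h j : Normc.normc ((A *m B) i j) <=
           \sum_k Normc.normc (A i k) * Normc.normc (B k j).
  rewrite mxE; apply: le_trans (normc_sum _ _ _) _.
  by apply: ler_sum => k _; rewrite Normc.normcM.
apply: le_trans (ler_sum _ (fun j _ => h j)) _.
rewrite exchange_big mulr_suml; apply: ler_sum => k _.
rewrite -mulr_sumr ler_wpM2l ?normc_ge0// /mxl1 (bigD1 k)//= lerDl.
by do 2!apply: sumr_ge0 => *; exact: normc_ge0.
Qed.

Section Equivalence.
Variables (ell : nat) (nrm : 'cV[R[i]]_ell -> R) (hn : is_norm nrm).

Lemma nrm0 : nrm 0 = 0.
Proof. by rewrite -(scale0r (0 : 'cV[R[i]]_ell)) (norm_scale hn) Normc.normc0 mul0r. Qed.

Lemma nrmN x : nrm (- x) = nrm x.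
Proof. by rewrite -scaleN1r (norm_scale hn) normcN Normc.normc1 mul1r. Qed.

Lemma nrm_ge0 x : 0 <= nrm x.
Proof.
have := norm_triangle hn x (- x); rewrite subrr nrm0 nrmN -mulr2n.
by rewrite pmulrn_lge0.
Qed.

Lemma nrm_sum (I : Type) (s : seq I) (Q : pred I) (F : I -> 'cV[R[i]]_ell) :
  nrm (\sum_(i <- s | Q i) F i) <= \sum_(i <- s | Q i) nrm (F i).
Proof.
elim/big_ind2 : _ => [|x1 x2 y1 y2 h1 h2|//]; first by rewrite nrm0.
exact: le_trans (norm_triangle hn _ _) (lerD h1 h2).
Qed.

Lemma nrm_le_mxl1 : exists2 K, 0 < K & forall x, nrm x <= K * mxl1 x.
Proof.
pose K := \sum_j nrm (delta_mx j 0).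
have K0 : 0 <= K by apply: sumr_ge0 => j _; exact: nrm_ge0.
exists (K + 1); first by lra.
move=> x; rewrite [in leLHS](matrix_sum_delta x).
apply: le_trans (nrm_sum _ _ _) _.
have h j : nrm (\sum_(k < 1) x j k *: delta_mx j k) <= nrm (delta_mx j 0) * mxl1 x.
  rewrite big_ord1 (norm_scale hn) mulrC ler_wpM2l ?nrm_ge0//; exact: le_mxl1.
apply: le_trans (ler_sum _ (fun j _ => h j)) _.
by rewrite -mulr_suml ler_wpM2r ?mxl1_ge0// lerDl.
Qed.

(** Compactness of the unit sphere of the real space [R^(2 ell)]: the map [phi]
    identifies it with [C^ell], the norm is Lipschitz there because it is
    dominated by [mxl1], and its minimum on the sphere is positive. *)
Lemma mxl1_le_nrm : (0 < ell)%N -> exists2 K, 0 < K & forall x, mxl1 x <= K * nrm x.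
Proof.
move=> ell0.
pose phi (w : 'rV[R]_(ell + ell)) : 'cV[R[i]]_ell :=
  \col_i (w 0 (lshift ell i) +i* w 0 (rshift ell i))%C.
have phiB w w' : phi (w - w') = phi w - phi w'.
  by apply/colP => i; rewrite !mxE.
have phiZ a w : phi (a *: w) = (a%:C)%C *: phi w.
  by apply/colP => i; rewrite !mxE; simpc.
have phi_bound w : mxl1 (phi w) <= (2 * ell)%:R * `|w|.
  have hw j : `|w 0 j| <= `|w|.
    rewrite [leRHS]/Num.norm /= mx_normrE; apply/bigmax_geP; right.
    by exists (0, j).
  have -> : (2 * ell)%:R * `|w| = \sum_(i < ell) (`|w| + `|w|).
    by rewrite sumr_const card_ord -mulr2n -mulrnA mulr_natl.
  apply: ler_sum => i _; rewrite big_ord1 mxE.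
  by apply: le_trans (normc_le _ _) _; exact: lerD.
have phi0 w : phi w = 0 -> w = 0.
  move=> /colP h; apply/rowP => j; rewrite mxE.
  case: (split_ordP j) => k ->; have := h k; rewrite !mxE => /eqP.
    by rewrite eq_complex /= => /andP[/eqP -> _].
  by rewrite eq_complex /= => /andP[_ /eqP ->].
have phi_onto v : exists w, phi w = v.
  exists (row_mx (\row_i complex.Re (v i 0)) (\row_i complex.Im (v i 0))).
  by apply/colP => i; rewrite mxE row_mxEl row_mxEr !mxE; case: (v i 0).
have [K K0 hK] := nrm_le_mxl1.
pose f w := nrm (phi w).
have fcont : continuous f.
  move=> w; have wF : Filter (nbhs w) by exact: nbhs_filter.
  apply/cvgrPdist_le => e e0.
  have K'0 : 0 < K * (2 * ell)%:R by rewrite mulr_gt0// ltr0n muln_gt0.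
  near=> w'.
  have dist a b : f a - f b <= K * (2 * ell)%:R * `|a - b|.
    rewrite lerBlDr /f -[in leLHS](subrK (phi b) (phi a)).
    apply: le_trans (norm_triangle hn _ _) _; rewrite lerD2r -phiB.
    apply: le_trans (hK _) _; rewrite -mulrA ler_pM2l//; exact: phi_bound.
  have dw : K * (2 * ell)%:R * `|w - w'| <= e.
    rewrite mulrC -ler_pdivlMr//; near: w'.
    by apply: cvgr_dist_le; rewrite ?divr_gt0//; exact: cvg_id.
  rewrite ler_norml; apply/andP; split.
    by rewrite lerNl opprB; apply: le_trans (dist _ _) _; rewrite distrC.
  exact: le_trans (dist _ _) _.
have /(compact_EVT_min (f := f))[] : [set w : 'rV[R]_(ell + ell) | `|w| = 1] !=set0.
- exists (const_mx 1) => /=; rewrite /Num.norm /= mx_normrE.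
  rewrite (eq_bigr (fun=> 1)) => [|j _]; last by rewrite mxE normr1.
  apply/eqP; rewrite eq_le; apply/andP; split.
    by apply/bigmax_leP.
  apply/bigmax_geP; right; exists (0, lshift ell (Ordinal ell0)) => //.
- apply: bounded_closed_compact.
    by exists 1; split=> [//|x x1 w /= ->]; exact: ltW.
  apply: (@closed_comp _ _ (fun w : 'rV[R]_(ell + ell) => `|w|) [set 1]).
    by move=> w _; exact: norm_continuous.
  exact: closed_eq.
- exact: continuous_subspaceT.
move=> c; rewrite inE /= => c1 hc.
have fc0 : 0 < f c.
  rewrite lt0r nrm_ge0 andbT; apply/eqP => /(norm_definite hn)/phi0 c0.
  by move: c1; rewrite c0 normr0 => /eqP; rewrite eq_sym oner_eq0.
exists ((2 * ell)%:R / f c); first by rewrite divr_gt0// ltr0n muln_gt0.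
move=> v; have [w <-] := phi_onto v; apply: le_trans (phi_bound _) _.
rewrite -mulrA ler_wpM2l ?ler0n// mulrC ler_pdivlMr//.
have [->|w0] := eqVneq w 0; first by rewrite normr0 mul0r nrm_ge0.
have nw : 0 < `|w| by rewrite normr_gt0.
have := hc (`|w|^-1 *: w); rewrite inE /= normrZ normfV normr_id mulVf ?gt_eqF//.
move=> /(_ erefl); rewrite /f phiZ (norm_scale hn) normc_real normfV normr_id.
by rewrite ler_pdivlMl.
Unshelve. all: by end_near. Qed.

End Equivalence.
End Norms.

(** * Generalized eigenspaces and adapted seminorms *)

Section Spectral.
Set Implicit Arguments.
Unset Strict Implicit.
Local Open Scope classical_set_scope.
Local Open Scope ring_scope.

Lemma mxdirect_sum_eq0 (F : fieldType) (I : finType) (m n : nat)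
    (D : I -> 'M[F]_(m, n)) (B : I -> 'M[F]_n) :
  mxdirect (\sum_i B i) -> (forall i, (D i <= B i)%MS) ->
  \sum_i D i = 0 -> forall i, D i = 0.
Proof.
move=> /mxdirect_sumsP dB DB D0 i; apply/eqP; rewrite -submx0 -(dB i isT).
rewrite sub_capmx DB/=; move: D0; rewrite (bigD1 i)//= => /eqP.
rewrite addr_eq0 => /eqP ->; rewrite eqmx_opp summx_sub_sums// => j _; exact: DB.
Qed.

Context {R : realType}.

Section Radius.
Variables (m n : nat) (A : 'M[R[i]]_m.+1) (chi : 'I_n.+1 -> \bar R).
Hypothesis hchi : log_moduli A chi.

(** The modulus [exp (chi j)] common to the eigenvalues in block [j]; unlike
    [chi j], it stays finite for the last block, where it is [0]. *)
Definition radius (j : 'I_n.+1) : R := expE (chi j).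

Lemma expE_logmod (mu : R[i]) : expE (logmod mu) = Normc.normc mu.
Proof. by rewrite /expE /logmod expeR_lne// normc_ge0. Qed.

Lemma radius_spec j : 0 <= radius j /\ chi j = lne (radius j)%:E.
Proof.
have [_ chimax chiim] := hchi.
have [->|jm] := eqVneq j ord_max.
  by rewrite /radius chimax /expE /= lexx.
have : [set chi j | j in [set j : 'I_n.+1 | j != ord_max]] (chi j) by exists j.
rewrite chiim /radius => -[mu _ <-]; rewrite expE_logmod; split=> //.
exact: normc_ge0.
Qed.

Lemma radius_max : radius ord_max = 0.
Proof. by have [_ chimax _] := hchi; rewrite /radius chimax. Qed.

Lemma radius_decreasing (j k : 'I_n.+1) : (j < k)%N -> radius k < radius j.
Proof.
have [chidec _ _] := hchi => /chidec; apply: contraTT; rewrite -!leNgt => /lne_le.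
by have [_ <-] := radius_spec j; have [_ <-] := radius_spec k.
Qed.

Lemma chi_inj : injective chi.
Proof.
have [chidec _ _] := hchi => j k cjk; apply/val_inj.
by case: (ltngtP j k) => // /chidec; rewrite cjk ltxx.
Qed.

Lemma eigenvalue_modulus (mu : R[i]) : mu \in spectrum A ->
  exists k, logmod mu = chi k.
Proof.
have [_ chimax chiim] := hchi => muA.
have [->|mu0] := eqVneq mu 0.
  by exists ord_max; rewrite chimax /logmod Normc.normc0 /= lexx.
have : [set logmod mu | mu in [set mu | mu \in spectrum A /\ mu != 0]] (logmod mu).
  by exists mu.
by rewrite -chiim => -[k _ <-]; exists k.
Qed.

(** The projections [P k] refine to operators [W i], one for each eigenvalue:
    split the rows of [(P k)^T] along the generalized eigenspaces whose sum
    contains them. The [W i] commute with [A] because [W i * A] and [A * W i]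
    both have their image in the [i]-th generalized eigenspace and both sum to
    [A]; by directness they agree. *)
Lemma spectral_components (P : 'I_n.+1 -> 'M[R[i]]_m.+1) :
  spectral_projections A chi P ->
  exists (p : nat) (mu : 'I_p -> R[i]) (W : 'I_p -> 'M[R[i]]_m.+1)
         (kap : 'I_p -> 'I_n.+1),
  [/\ \sum_i W i = 1,
      forall i, W i * A = A * W i,
      forall i, (A - (mu i)%:M) ^+ m.+1 * W i = 0,
      forall i, Normc.normc (mu i) = radius (kap i)
    & forall k, P k = \sum_(i | kap i == k) W i].
Proof.
move=> [_ Pim Psum].
pose p := size (spectrum A); pose mu := tnth (in_tuple (spectrum A)).
have muS i : mu i \in spectrum A by exact: mem_tnth.
have mu_inj : injective mu.
  by apply/tuple_uniqP; rewrite undup_uniq.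
pose G i := geigenspace A^T (mu i).
have [kap hkap] := choice (fun i => eigenvalue_modulus (muS i)).
have Psub k : ((P k)^T <= \sum_(i | kap i == k) G i)%MS.
  rewrite (Pim k) /modulus_space big_tnth.
  rewrite (eq_bigl (fun i => kap i == k))// => i.
  by rewrite -/(mu i) hkap (inj_eq chi_inj).
have {Psub} hu k : exists u : 'I_p -> 'M[R[i]]_m.+1,
    (P k)^T = \sum_(i | kap i == k) u i *m G i by exact/sub_sumsmxP.
have [u {}hu] := choice hu.
pose W i := (u (kap i) i *m G i)^T.
have WP k : P k = \sum_(i | kap i == k) W i.
  apply: trmx_inj; rewrite hu raddf_sum; apply: eq_bigr => i /eqP <-.
  by rewrite /= trmxK.
have Wsum : \sum_i W i = 1.
  rewrite -[RHS]Psum (partition_big kap xpredT)//=.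
  by apply: eq_bigr => k _; rewrite WP.
have WG i : ((W i)^T <= G i)%MS by rewrite trmxK submxMl.
have WA i : W i * A = A * W i.
  apply/eqP; rewrite -subr_eq0; apply/eqP; apply: trmx_inj; rewrite trmx0.
  pose D i := (W i * A - A * W i)^T.
  apply: (@mxdirect_sum_eq0 _ _ _ _ D G).
  - by apply: mxdirect_sum_geigenspace => ? ? _ _; exact: mu_inj.
  - move=> j; rewrite /D raddfB /= !trmx_mul; apply: addmx_sub.
      by apply: submx_trans (submxMl _ _) (WG j).
    rewrite eqmx_opp; apply: submx_trans (submxMr _ (WG j)) _.
    exact: comm_mx_stable_geigenspace.
  - rewrite -raddf_sum sumrB -mulr_suml -mulr_sumr Wsum mul1r mulr1 subrr.
    exact: trmx0.
exists p, mu, W, kap; split => // [i|i]; last first.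
  by rewrite /radius -hkap expE_logmod.
have trX (X : 'M[R[i]]_m.+1) k : X ^+ k = ((X^T) ^+ k)^T.
  elim: k => [|k IH]; first by rewrite !expr0 trmx1.
  by rewrite exprSr IH exprS -mulmxE trmx_mul trmxK.
have /sub_kermxP := WG i; rewrite -/(geigenspace _ _).
have -> : (A - (mu i)%:M) ^+ m.+1 = (((A^T - (mu i)%:M) ^+ m.+1)^T).
  by rewrite trX raddfB /= tr_scalar_mx.
rewrite rmorphXn rmorphB /= horner_mx_X horner_mx_C => WM.
by apply: trmx_inj; rewrite -mulmxE trmx_mul trmx0 [X in _ *m X]trmxK.
Qed.

End Radius.

Section AdaptedSeminorm.
Variables (m : nat) (A W : 'M[R[i]]_m.+1) (mu : R[i]) (e : R).
Hypotheses (WA : W * A = A * W) (WM : (A - mu%:M) ^+ m.+1 * W = 0) (e0 : 0 < e).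

(** On the image of [W] the operator [A] is [mu] plus the nilpotent [A - mu].
    Giving the [s]-th iterate of the nilpotent part the weight [e ^- s] makes
    its norm at most [e], as after scaling the off-diagonal entries of a Jordan
    block to [e]. The same seminorm thus bounds [A] from above and below. *)
Definition adapted (v : 'cV[R[i]]_m.+1) : R :=
  \sum_(s < m.+1) e ^- s * mxl1 ((A - mu%:M) ^+ s *m (W *m v)).

Lemma weight_ge0 s : 0 <= e ^- s.
Proof. by rewrite invr_ge0 exprn_ge0// ltW. Qed.

Lemma adapted_ge0 v : 0 <= adapted v.
Proof.
by apply: sumr_ge0 => s _; rewrite mulr_ge0 ?mxl1_ge0 ?weight_ge0.
Qed.

Lemma adaptedD u v : adapted (u + v) <= adapted u + adapted v.
Proof.
rewrite /adapted -big_split; apply: ler_sum => s _ /=; rewrite -mulrDr.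
by rewrite ler_wpM2l ?weight_ge0// !mulmxDr mxl1D.
Qed.

Lemma adaptedB u v : adapted u - adapted v <= adapted (u + v).
Proof.
rewrite /adapted -sumrB; apply: ler_sum => s _ /=; rewrite -mulrBr.
by rewrite ler_wpM2l ?weight_ge0// !mulmxDr mxl1B.
Qed.

Lemma mxl1_le_adapted v : mxl1 (W *m v) <= adapted v.
Proof.
rewrite /adapted big_ord_recl expr0 invr1 mul1r mul1mx lerDl.
by apply: sumr_ge0 => s _; rewrite mulr_ge0 ?mxl1_ge0 ?weight_ge0.
Qed.

Lemma adapted_le_mxl1 : exists2 K, 0 < K & forall v, adapted v <= K * mxl1 v.
Proof.
pose K := \sum_(s < m.+1) e ^- s * (mxl1 ((A - mu%:M) ^+ s) * mxl1 W).
have K0 : 0 <= K.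
  by apply: sumr_ge0 => s _; rewrite mulr_ge0 ?mulr_ge0 ?mxl1_ge0 ?weight_ge0.
exists (K + 1); first by lra.
move=> v; apply: (@le_trans _ _ (K * mxl1 v)); last first.
  by rewrite ler_wpM2r ?mxl1_ge0// lerDl.
rewrite /adapted /K mulr_suml; apply: ler_sum => s _.
rewrite -!mulrA ler_wpM2l ?weight_ge0//.
apply: le_trans (mxl1M _ _) _; rewrite ler_wpM2l ?mxl1_ge0//; exact: mxl1M.
Qed.

(** Multiplying by [A - mu] shifts the terms of the sum by one place; the last
    one falls off because [(A - mu) ^+ m.+1] vanishes on the image of [W]. *)
Lemma nilpotent_shift v :
  \sum_(s < m.+1) e ^- s * mxl1 ((A - mu%:M) ^+ s.+1 *m (W *m v)) <= e * adapted v.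
Proof.
pose a s := e ^- s * mxl1 ((A - mu%:M) ^+ s *m (W *m v)).
have am : a m.+1 = 0.
  by rewrite /a mulmxA [_ *m W]WM mul0mx mxl1_0 mulr0.
have a0 : 0 <= a 0%N by rewrite /a expr0 invr1 mul1r mxl1_ge0.
have -> : \sum_(s < m.+1) e ^- s * mxl1 ((A - mu%:M) ^+ s.+1 *m (W *m v)) =
          e * \sum_(s < m.+1) a s.+1.
  rewrite mulr_sumr; apply: eq_bigr => s _.
  by rewrite /a mulrA [e ^+ s.+1]exprS invfM mulrA divff ?gt_eqF// mul1r.
rewrite ler_pM2l//; have : \sum_(s < m.+2) a s = adapted v.
  by rewrite big_ord_recr /= am addr0.
by rewrite big_ord_recl /= => <-; rewrite lerDr.
Qed.

Lemma adapted_shiftE s (v : 'cV[R[i]]_m.+1) : (A - mu%:M) ^+ s *m (W *m (A *m v)) =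
  mu *: ((A - mu%:M) ^+ s *m (W *m v)) + (A - mu%:M) ^+ s.+1 *m (W *m v).
Proof.
have -> : W *m (A *m v) = A *m (W *m v) by rewrite !mulmxA [W *m A]WA.
rewrite -{2}(subrK mu%:M A) mulmxDl mulmxDr mul_scalar_mx -scalemxAr addrC.
by rewrite exprSr -mulmxE mulmxA.
Qed.

Lemma adapted_le v : adapted (A *m v) <= (Normc.normc mu + e) * adapted v.
Proof.
rewrite mulrDl; apply: le_trans (lerD (lexx _) (nilpotent_shift v)).
rewrite /adapted mulr_sumr -big_split; apply: ler_sum => s _ /=.
rewrite mulrCA -mulrDr ler_wpM2l ?weight_ge0//.
by rewrite adapted_shiftE -mxl1Z mxl1D.
Qed.

Lemma adapted_ge v : (Normc.normc mu - e) * adapted v <= adapted (A *m v).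
Proof.
rewrite mulrBl; apply: le_trans (lerB (lexx _) (nilpotent_shift v)) _.
rewrite /adapted mulr_sumr -sumrB; apply: ler_sum => s _ /=.
rewrite mulrCA -mulrBr ler_wpM2l ?weight_ge0//.
by rewrite adapted_shiftE -mxl1Z mxl1B.
Qed.

End AdaptedSeminorm.
End Spectral.

(** * Perturbed orbits *)

Section Orbits.
Set Implicit Arguments.
Unset Strict Implicit.
Local Open Scope ring_scope.
Context {R : realType}.

Lemma finite_family_gap (I : finType) (f : I -> R) (b : R) :
  0 < b -> (forall i, 0 < f i) -> exists2 e : R, 0 < e & e <= b /\ forall i, e <= f i.
Proof.
move=> b0 f0; exists (\big[Num.min/b]_i f i).
  by apply: lt_bigmin.
split=> [|i]; [exact: bigmin_le_id|exact: bigmin_le_cond].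
Qed.

Variables (m : nat) (A : 'M[R[i]]_m.+1) (p : nat) (mu : 'I_p -> R[i])
  (W : 'I_p -> 'M[R[i]]_m.+1) (l : R).
Hypotheses (Wsum : \sum_i W i = 1) (WA : forall i, W i * A = A * W i)
  (WM : forall i, (A - (mu i)%:M) ^+ m.+1 * W i = 0) (l1 : 1 < l).

Variables (x : nat -> 'cV[R[i]]_m.+1) (D : R).
Hypotheses (D0 : 0 <= D)
  (xS : forall n, mxl1 (x n.+1 - A *m x n) <= D * l ^- n * mxl1 (x n)).

Lemma mxl1_components (v : 'cV[R[i]]_m.+1) : mxl1 v <= \sum_i mxl1 (W i *m v).
Proof.
by rewrite -{1}(mul1mx v) -[1%:M]Wsum mulmx_suml; exact: mxl1_sum.
Qed.

Let l0 : 0 < l. Proof. exact: lt_trans l1. Qed.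

(** The two alternatives of [fast_slow_dichotomy] for a perturbed orbit of [A],
    at a gap [s < r] of the moduli that separates the fast indices from the
    slow ones. The first alternative also records that there is a fast index,
    which excludes it above all the moduli. *)
Lemma orbit_dichotomy (fast : pred 'I_p) (s r : R) : 0 < s -> s < r ->
  (forall i, fast i -> r < Normc.normc (mu i)) ->
  (forall i, ~~ fast i -> Normc.normc (mu i) < s) ->
  (exists i, fast i) /\ (exists2 c : R, 0 < c & exists n0 : nat,
     forall n, (n0 <= n)%N -> c * r ^+ n <= mxl1 (x n)) \/
  (exists2 K : R, 0 < K & exists n0 : nat, forall n, (n0 <= n)%N ->
     mxl1 (x n) <= K * s ^+ n /\
     forall i, fast i -> mxl1 (W i *m x n) <= K * l ^- n * mxl1 (x n)).
Proof.
move=> s0 sr hfast hslow.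
(* The seminorm costs e in each modulus and the scalar dichotomy needs the
   strict margin e again, so e is at most half of every distance to s or r;
   e <= s keeps s - e nonnegative. *)
pose gap i := if fast i then (Normc.normc (mu i) - r) / 2
              else (s - Normc.normc (mu i)) / 2.
have [|e e0 [es eg]] := @finite_family_gap _ gap s s0.
  move=> i; rewrite /gap; case: ifPn => [/hfast|/hslow] ?; lra.
pose N i := adapted A (W i) (mu i) e.
have N0 i v : 0 <= N i v by exact: adapted_ge0.
have hNK i : exists K, 0 < K /\ forall v, N i v <= K * mxl1 v.
  by have [K K0 hK] := @adapted_le_mxl1 _ _ A (W i) (mu i) _ e0; exists K.
have {hNK} [K hK] := choice hNK.
have K0 i : 0 < K i by have [] := hK i.
have {}hK i v : N i v <= K i * mxl1 v by have [_] := hK i; apply.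
pose Kt := \sum_i K i; have Kt0 : 0 <= Kt by apply: sumr_ge0 => i _; exact: ltW.
pose S n := \sum_(i | fast i) N i (x n).
pose T n := \sum_(i | ~~ fast i) N i (x n).
have S0 n : 0 <= S n by exact: sumr_ge0.
have T0 n : 0 <= T n by exact: sumr_ge0.
have STx n : mxl1 (x n) <= S n + T n.
  apply: le_trans (mxl1_components _) _; rewrite (bigID fast) /=.
  by apply: lerD; apply: ler_sum => i _; exact: mxl1_le_adapted.
have subK (Q : pred 'I_p) v : \sum_(i | Q i) N i v <= Kt * mxl1 v.
  rewrite /Kt mulr_suml [leRHS](bigID Q) /=.
  apply: (@le_trans _ _ (\sum_(i | Q i) K i * mxl1 v)); first exact: ler_sum.
  by rewrite lerDl sumr_ge0// => i _; rewrite mulr_ge0 ?mxl1_ge0 ?ltW.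
pose err n := x n.+1 - A *m x n.
have xE n : x n.+1 = A *m x n + err n by rewrite /err addrC subrK.
have errK (Q : pred 'I_p) n :
    \sum_(i | Q i) N i (err n) <= Kt * D * l ^- n * (S n + T n).
  apply: le_trans (subK _ _) _; rewrite -!mulrA ler_wpM2l//.
  apply: le_trans (xS n) _; rewrite -mulrA ler_wpM2l// ler_wpM2l//.
  by rewrite invr_ge0 exprn_ge0 ?ltW.
have hS n : (r + e) * S n <= S n.+1 + Kt * D * l ^- n * (S n + T n).
  rewrite -lerBlDr; apply: (le_trans (lerB (lexx _) (errK fast n))).
  rewrite /S mulr_sumr -sumrB; apply: ler_sum => i fi.
  rewrite xE; apply: le_trans _ (adaptedB _ _ _ e0 _ _).
  rewrite lerD2r; apply: le_trans _ (adapted_ge (WA i) (WM i) e0 _).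
  rewrite ler_wpM2r ?(adapted_ge0 _ _ _ e0)//.
  by have := eg i; rewrite /gap fi; lra.
have hT n : T n.+1 <= (s - e) * T n + Kt * D * l ^- n * (S n + T n).
  apply: le_trans _ (lerD (lexx _) (errK (predC fast) n)).
  rewrite /T mulr_sumr -big_split; apply: ler_sum => i fi /=.
  rewrite xE; apply: le_trans (adaptedD _ _ _ e0 _ _) _.
  rewrite lerD2r; apply: le_trans (adapted_le (WA i) (WM i) e0 _) _.
  rewrite ler_wpM2r ?(adapted_ge0 _ _ _ e0)//.
  by have := eg i; rewrite /gap (negbTE fi); lra.
have [se0 ses rre] : [/\ 0 <= s - e, s - e < s & r < r + e] by split; lra.
have [[c c0 [n0 hc]]|[K1 K10 [n0 hK1]]] := fast_slow_dichotomy l1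
  (mulr_ge0 Kt0 D0) se0 ses sr rre S0 T0 hS hT.
  have cpos n : 0 < c * r ^+ n by rewrite mulr_gt0// exprn_gt0//; lra.
  have hcx n : (n0 <= n)%N -> c * r ^+ n <= (Kt + 1) * mxl1 (x n).
    move=> /hc /le_trans; apply; apply: le_trans (subK _ _) _.
    by rewrite ler_wpM2r ?mxl1_ge0//; lra.
  left; split.
    apply: contrapT => /forallNP nofast; have := lt_le_trans (cpos n0) (hc n0 (leqnn _)).
    by rewrite /S big1 ?ltxx// => i /nofast.
  exists (c / (Kt + 1)); first by rewrite divr_gt0//; lra.
  exists n0 => n n0n; rewrite mulrAC ler_pdivrMr; last by lra.
  by rewrite [leRHS]mulrC; exact: hcx.
right; exists ((1 + K1) * K1 + K1 * (Kt + 1)).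
  by rewrite addr_gt0// mulr_gt0//; lra.
exists n0 => n n0n; have [hT1 hS1] := hK1 n n0n.
have ln : 0 <= l ^- n <= 1.
  by rewrite invr_ge0 exprn_ge0 ?invf_le1 ?exprn_gt0 ?exprn_ege1 ?ltW.
have sn : 0 < s ^+ n by rewrite exprn_gt0.
have K1l : K1 * l ^- n <= K1 by rewrite ger_pMr//; case/andP: ln.
have K1l0 : 0 <= K1 * l ^- n by case/andP: ln => ? _; rewrite mulr_ge0// ltW.
split=> [|i fi].
  apply: le_trans (STx n) _.
  have h1 : S n <= K1 * T n by apply: le_trans hS1 _; rewrite ler_wpM2r.
  have h2 : K1 * T n <= K1 * (K1 * s ^+ n) by rewrite ler_pM2l.
  have h3 : 0 <= K1 * (Kt + 1) * s ^+ n.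
    by apply: mulr_ge0; [apply: mulr_ge0; lra|exact: ltW].
  lra.
have h1 : mxl1 (W i *m x n) <= S n.
  apply: le_trans (mxl1_le_adapted A (W i) (mu i) e0 _) _.
  rewrite /S (bigD1 i)//= lerDl sumr_ge0// => j _; exact: N0.
apply: (le_trans h1); apply: (le_trans hS1).
have h2 : T n <= (Kt + 1) * mxl1 (x n).
  apply: le_trans (subK _ _) _; rewrite ler_wpM2r ?mxl1_ge0//; lra.
have h3 : K1 * l ^- n * T n <= K1 * l ^- n * ((Kt + 1) * mxl1 (x n)) by rewrite ler_wpM2l.
apply: (le_trans h3); rewrite mulrA ler_wpM2r ?mxl1_ge0// mulrAC ler_wpM2r//.
  by case/andP: ln.
by rewrite lerDr mulr_ge0//; lra.
Qed.

(** The [i]-th component is multiplied by at most [|mu i| + e] and fed by an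
    error of size [l ^- n * s ^+ n]; it follows whichever is larger. *)
Lemma component_growth (i : 'I_p) (s t K : R) (n0 : nat) : 0 < s -> 0 <= K ->
  s / l <= t -> Normc.normc (mu i) < t ->
  (forall n, (n0 <= n)%N -> mxl1 (x n) <= K * s ^+ n) ->
  exists2 C : R, 0 < C & forall n, (n0 <= n)%N -> mxl1 (W i *m x n) <= C * t ^+ n.
Proof.
move=> s0 K0 st mut hx; pose e := (t - Normc.normc (mu i)) / 2.
have e0 : 0 < e by rewrite /e; lra.
pose N := adapted A (W i) (mu i) e.
have [L L0 hL] := @adapted_le_mxl1 _ _ A (W i) (mu i) _ e0.
have t0 : 0 <= t by apply: le_trans st; rewrite divr_ge0 ?ltW.
have step n : (n0 <= n)%N ->
    N (x n.+1) <= (Normc.normc (mu i) + e) * N (x n) + L * D * K * t ^+ n.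
  move=> n0n.
  have -> : x n.+1 = A *m x n + (x n.+1 - A *m x n) by rewrite addrC subrK.
  apply: le_trans (adaptedD _ _ _ e0 _ _) _; apply: lerD.
    exact: adapted_le (WA i) (WM i) e0 _.
  apply: le_trans (hL _) _; rewrite -!mulrA ler_pM2l//.
  apply: le_trans (xS n) _; rewrite -mulrA ler_wpM2l//.
  have ln : 0 <= l ^- n by rewrite invr_ge0 exprn_ge0 ?ltW.
  have h1 : l ^- n * mxl1 (x n) <= l ^- n * (K * s ^+ n) by rewrite ler_wpM2l ?hx.
  apply: (le_trans h1); rewrite mulrCA ler_wpM2l// mulrC -exprVn -exprMn.
  by rewrite lerXn2r ?nnegrE// divr_ge0 ?ltW.
have a0 : 0 <= Normc.normc (mu i) + e by rewrite addr_ge0 ?normc_ge0 ?ltW.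
have ast : Normc.normc (mu i) + e < t by rewrite /e; lra.
have LDK : 0 <= L * D * K by rewrite !mulr_ge0// ltW.
have [C C0 hC] := geometric_decay a0 ast LDK step.
exists C => // n /hC; apply: le_trans.
exact: mxl1_le_adapted.
Qed.

End Orbits.

(** * Splittings of flags *)

Section Flags.
Set Implicit Arguments.
Unset Strict Implicit.
Local Open Scope ring_scope.

Definition subspace_pred (F : fieldType) (n : nat) (V : 'cV[F]_n -> Prop) :=
  V 0 /\ forall a u v, V u -> V v -> V (a *: u + v).

(** A matrix [B] of maximal rank among those with image in [V] has image [V]:
    otherwise a missing vector could be added to its columns.  The projection is
    [B] times a partial inverse, transposed since ranks and row spaces live on
    the transposed side. *)
Lemma subspace_projection (F : fieldType) (n : nat) (V : 'cV[F]_n -> Prop) :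
  subspace_pred V ->
  exists p : 'M[F]_n, (forall x, V (p *m x)) /\ (forall x, V x -> p *m x = x).
Proof.
move=> VS; have [V0 VD] := VS.
pose rank_in r := `[< exists B : 'M[F]_n, (forall x, V (B *m x)) /\ \rank B = r >].
have ex0 : exists r, rank_in r.
  exists 0%N; apply/asboolP; exists 0; split; last exact: mxrank0.
  by move=> x; rewrite mul0mx.
have bnd r : rank_in r -> (r <= n)%N.
  by move=> /asboolP[B [_ <-]]; exact: rank_leq_row.
case: (ex_maxnP ex0 bnd) => r /asboolP[B [BV <-]] maxB.
have Vsub v : V v -> (v^T <= B^T)%MS.
  move=> Vv; pose C := ((B^T + v^T)%MS)^T.
  have CV x : V (C *m x).
    have : (x^T *m C^T <= B^T + v^T)%MS by rewrite /C trmxK submxMl.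
    move=> /sub_addsmxP[[u1 u2]] /= /(congr1 trmx).
    rewrite linearD /= !trmx_mul !trmxK => ->.
    rewrite addrC; have -> : v *m u2^T = (u2 0 0) *: v.
      apply/colP => k; rewrite !mxE big_ord1 !mxE mulrC; congr (_ * _).
    by apply: VD => //; exact: BV.
  have BC : (B^T <= C^T)%MS by rewrite /C trmxK addsmxSl.
  have rCB : \rank B^T = \rank C^T.
    apply/eqP; rewrite eqn_leq mxrankS//= [\rank B^T]mxrank_tr.
    rewrite -[\rank C^T]mxrank_tr maxB//; apply/asboolP; exists C^T^T; split=> // x.
    by rewrite trmxK; exact: CV.
  have : (C^T <= B^T)%MS by rewrite -(mxrank_leqif_sup BC) rCB.
  by apply: submx_trans; rewrite /C trmxK addsmxSr.
exists ((pinvmx B^T *m B^T)^T); split=> x.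
  by rewrite trmx_mul trmxK -mulmxA; exact: BV.
move=> /Vsub xB; apply: trmx_inj; rewrite trmx_mul trmxK mulmxA.
exact: mulmxKpV.
Qed.

(** Compose projections down the flag, [r (j+1) = p (j+1) r j].  Then [r j] is
    the identity on [V j] and [r (j+1) r j = r (j+1)], so that
    [Q j = r j - r (j+1)] takes values in [V j] and is killed by [r (j+1)],
    which fixes [V (j+1)]. *)
Lemma flag_splitting (F : fieldType) (m n : nat) (V : nat -> 'cV[F]_m -> Prop) :
  (forall j, subspace_pred (V j)) -> (forall x, V 0%N x) ->
  (forall j x, (j < n)%N -> V j.+1 x -> V j x) ->
  exists Q : 'I_n.+1 -> 'M[F]_m,
    \sum_j Q j = 1%:M /\
    forall (j : 'I_n.+1) x, V j (Q j *m x) /\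
      ((j < n)%N -> V j.+1 (Q j *m x) -> Q j *m x = 0).
Proof.
move=> VS V0 Vdec.
have [p hp] := choice (fun j => subspace_projection (VS j)).
pose r := fix r (j : nat) : 'M[F]_m := if j is j'.+1 then p j *m r j' else 1%:M.
have rV j x : V j (r j *m x).
  by case: j => [|j] //=; rewrite -mulmxA; have [+ _] := hp j.+1; apply.
have rid j x : (j <= n)%N -> V j x -> r j *m x = x.
  elim: j => [_ _|j IH jn Vx /=]; first by rewrite mul1mx.
  by rewrite -mulmxA IH; [have [_ +] := hp j.+1; apply|exact: ltnW|exact: Vdec].
pose Q (j : 'I_n.+1) := r j - (if (j < n)%N then r j.+1 else 0).
exists Q; split.
  rewrite /Q big_ord_recr /= ltnn subr0.
  rewrite (eq_bigr (fun j : 'I_n => r j - r j.+1)) => [|j _]; last by rewrite ltn_ord.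
  have -> : \sum_(j < n) (r j - r j.+1) = 1%:M - r n; last by rewrite subrK.
  rewrite -[RHS]opprB -(telescope_sumr r (leq0n n)) big_mkord -sumrN.
  by apply: eq_bigr => j _; rewrite opprB.
move=> j x; rewrite /Q; case: ifPn => jn; last by rewrite subr0; split=> //; exact: rV.
have [_ VD] := VS j.
split=> [|_ VQ].
  rewrite mulmxBl -scaleN1r addrC; apply: VD; last exact: rV.
  by apply: Vdec => //; exact: rV.
have rr : r j.+1 *m (r j *m x) = r j.+1 *m x.
  by rewrite /= -!mulmxA (rid j (r j *m x))// -ltnS.
by rewrite -(rid _ _ jn VQ) mulmxBl mulmxBr rr (rid j.+1 (r j.+1 *m x)) ?subrr.
Qed.

End Flags.

(** * The filtration by growth rates *)

Section Splitting.
Set Implicit Arguments.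
Unset Strict Implicit.
Local Open Scope ring_scope.
Context {R : realType}.

(** What makes the two alternatives of [orbit_dichotomy] exclusive. *)
Lemma geometric_rate_unique (a b c K : R) (n0 : nat) : 0 < a -> a < b -> 0 < c ->
  ~ (forall n, (n0 <= n)%N -> c * b ^+ n <= K * a ^+ n).
Proof.
move=> a0 ab c0 h; have b0 : 0 < b by apply: lt_trans ab.
have K0 : 0 <= K.
  have := h n0 (leqnn _); have : 0 < c * b ^+ n0 by rewrite mulr_gt0 ?exprn_gt0.
  move=> /lt_le_trans h1 /h1; rewrite pmulr_lgt0 ?exprn_gt0//; exact: ltW.
have ba : 1 < b / a by rewrite ltr_pdivlMr// mul1r.
have [n1 hn1] := geometric_small ba K0 (divr_gt0 c0 (ltr0n _ 2)).
have := hn1 (maxn n0 n1) (leq_maxr _ _); have := h (maxn n0 n1) (leq_maxl _ _).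
set N := maxn _ _ => h1.
rewrite expr_div_n invf_div ler_pdivlMr ?ltr0n//.
have bN : 0 < b ^+ N by rewrite exprn_gt0.
rewrite mulrA mulrAC ler_pdivrMr//.
have : 0 < c * b ^+ N by rewrite mulr_gt0.
lra.
Qed.

Variables (m : nat) (A : 'M[R[i]]_m.+1) (p : nat) (mu : 'I_p -> R[i])
  (W : 'I_p -> 'M[R[i]]_m.+1) (l : R).
Hypotheses (Wsum : \sum_i W i = 1) (WA : forall i, W i * A = A * W i)
  (WM : forall i, (A - (mu i)%:M) ^+ m.+1 * W i = 0) (l1 : 1 < l).
Variables (n : nat) (r : 'I_n.+1 -> R) (kap : 'I_p -> 'I_n.+1).
Hypotheses (mur : forall i, Normc.normc (mu i) = r (kap i))
  (r0 : forall j, 0 <= r j) (rmax : r ord_max = 0)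
  (rdec : forall j k : 'I_n.+1, (j < k)%N -> r k < r j).
Variables (M : nat -> 'M[R[i]]_m.+1) (D : R).
Hypotheses (D0 : 0 <= D) (MS : forall (y : 'cV[R[i]]_m.+1) N,
  mxl1 (M N.+1 *m y - A *m (M N *m y)) <= D * l ^- N * mxl1 (M N *m y)).

(** A number strictly between the moduli of the blocks [j] and [j - 1], and
    above all of them for [j = 0].  The index is a natural number so that
    [threshold j.+1] can be written; [inord] is faithful up to [n]. *)
Definition threshold (j : nat) : R :=
  if j is j'.+1 then (r (inord j') + r (inord j'.+1)) / 2 else r ord0 + 1.

(** One fixed ratio in the gap above [r j] defines the same subspace as any
    other ratio in this gap, by [slow_upper], and makes linearity obvious. *)
Definition slow (j : nat) (y : 'cV[R[i]]_m.+1) : Prop :=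
  lesssim (fun N => mxl1 (M N *m y)) (fun N => threshold j ^+ N).

Lemma threshold_gt (j : 'I_n.+1) : r j < threshold j.
Proof.
case: j => -[|j] jn /=.
  by rewrite (_ : Ordinal jn = ord0) ?ltrDl//; exact: val_inj.
have -> : Ordinal jn = inord j.+1 by apply: val_inj; rewrite /= inordK.
have : r (inord j.+1) < r (inord j) by apply: rdec; rewrite !inordK// ltnW.
by rewrite /threshold; lra.
Qed.

Lemma radius_mono (j k : 'I_n.+1) : (j <= k)%N -> r k <= r j.
Proof. by rewrite leq_eqVlt => /orP[/eqP/val_inj -> //|/rdec/ltW]. Qed.

Lemma threshold_lt (k : 'I_n.+1) (j : nat) : (k < j)%N -> (j <= n)%N -> threshold j < r k.
Proof.
case: j => // j; rewrite ltnS => kj jn /=.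
have : r (inord j.+1) < r (inord j) by apply: rdec; rewrite !inordK ?ltnS// ltnW.
have : r (inord j) <= r k by apply: radius_mono; rewrite inordK// ltnS ltnW.
lra.
Qed.

Lemma threshold_gt0 (j : nat) : (j <= n)%N -> 0 < threshold j.
Proof.
by rewrite -ltnS => jn; apply: le_lt_trans (threshold_gt (Ordinal jn)).
Qed.

Lemma threshold_ge0 (j : nat) : 0 <= threshold j.
Proof.
by case: j => [|j] /=; [rewrite addr_ge0|rewrite divr_ge0 ?addr_ge0].
Qed.

(** An orbit bounded by [threshold j ^+ N] cannot be in the first alternative of
    the dichotomy at a gap whose upper end [rho] exceeds [threshold j]; so it is
    in the second, with the lower end of the gap as close to [r j] as desired. *)
Lemma slow_upper (j : 'I_n.+1) y : slow j y ->
  (forall t, r j < t -> lesssim (fun N => mxl1 (M N *m y)) (fun N => t ^+ N)) /\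
  (exists2 K : R, 0 < K & exists n0 : nat, forall N, (n0 <= N)%N -> forall i,
     (kap i < j)%N -> mxl1 (W i *m (M N *m y)) <= K * l ^- N * mxl1 (M N *m y)).
Proof.
move=> [K K0 [n0 hK]].
have th0 : 0 < threshold j by apply: threshold_gt0; rewrite -ltnS.
have predj : (0 < j)%N -> ((inord j.-1 : 'I_n.+1) < j)%N.
  by move=> j0; rewrite inordK ?prednK//; exact: ltnW (ltn_ord j).
have main s : r j < s -> s <= threshold j ->
    exists2 K : R, 0 < K & exists n0 : nat, forall N, (n0 <= N)%N ->
     mxl1 (M N *m y) <= K * s ^+ N /\
     forall i, (kap i < j)%N -> mxl1 (W i *m (M N *m y)) <= K * l ^- N * mxl1 (M N *m y).
  move=> rs st.
  have s0 : 0 < s by apply: le_lt_trans rs.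
  pose rho := if (0 < j)%N then (threshold j + r (inord j.-1)) / 2 else threshold j + 1.
  have thr : threshold j < rho.
    rewrite /rho; case: ifPn => j0; last by lra.
    have := threshold_lt (predj j0) (ltn_ord j); lra.
  have hfast i : (kap i < j)%N -> rho < Normc.normc (mu i).
    move=> ij; have j0 : (0 < j)%N by exact: leq_ltn_trans ij.
    have := threshold_lt (predj j0) (ltn_ord j).
    have : r (inord j.-1) <= r (kap i).
      apply: radius_mono; rewrite inordK; first by rewrite -ltnS prednK.
      exact: leq_ltn_trans (leq_pred j) (ltn_ord j).
    by rewrite mur /rho j0; lra.
  have hslow i : ~~ (kap i < j)%N -> Normc.normc (mu i) < s.
    rewrite -leqNgt mur leq_eqVlt => /orP[/eqP/val_inj <- //|/rdec h].
    exact: lt_trans rs.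
  have [[_ [c c0 [n1 hc]]]|//] := @orbit_dichotomy R m A p mu W l Wsum WA WM l1
      (fun N => M N *m y) D D0 (MS y) (fun i => kap i < j)%N s rho s0
      (le_lt_trans st thr) hfast hslow.
  exfalso; apply: (@geometric_rate_unique (threshold j) rho c K (maxn n0 n1) th0 thr c0).
  move=> N; rewrite geq_max => /andP[n0N n1N].
  by apply: le_trans (hc N n1N) _; exact: hK.
split=> [t rt|].
  have [||K1 K10 [n1 hK1]] := main (Num.min t (threshold j)).
  - by rewrite lt_min rt threshold_gt.
  - by rewrite ge_min lexx orbT.
  exists K1 => //; exists n1 => N /hK1[h _]; apply: le_trans h _.
  have t0 : 0 <= t by apply: le_trans (r0 j) (ltW rt).
  by rewrite ler_pM2l// lerXn2r ?nnegrE ?le_min ?ge_min ?t0 ?(ltW th0) ?lexx.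
have [K1 K10 [n1 hK1]] := main (threshold j) (threshold_gt j) (lexx _).
by exists K1 => //; exists n1 => N /hK1[_ h].
Qed.

(** At the gap just above block [j.+1], an orbit which is not slow is in the
    first alternative, with the upper end of the gap as close to [r j] as
    desired. *)
Lemma not_slow_lower (j : 'I_n.+1) y : (j < n)%N -> ~ slow j.+1 y ->
  forall t, 0 < t -> t < r j ->
  lesssim (fun N => t ^+ N) (fun N => mxl1 (M N *m y)).
Proof.
move=> jn nslow t t0 tr.
have th := threshold_lt (ltnSn j) jn; have th0 := threshold_gt0 jn.
pose rho := Num.max t ((threshold j.+1 + r j) / 2).
have rhor : rho < r j by rewrite gt_max tr andTb; lra.
have thr : threshold j.+1 < rho by rewrite lt_max; apply/orP; right; lra.
have hfast i : (kap i < j.+1)%N -> rho < Normc.normc (mu i).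
  rewrite mur ltnS leq_eqVlt => /orP[/eqP/val_inj -> //|/rdec]; exact: lt_trans.
have hslow i : ~~ (kap i < j.+1)%N -> Normc.normc (mu i) < threshold j.+1.
  rewrite -leqNgt mur => ij.
  have jn1 : (j.+1 < n.+1)%N by rewrite ltnS.
  apply: le_lt_trans (threshold_gt (Ordinal jn1)).
  have [->//|ne] := eqVneq (kap i) (Ordinal jn1).
  by apply/ltW/rdec; rewrite ltn_neqAle ij andbT eq_sym; exact: ne.
have [[_ [c c0 [n1 hc]]]|[K K0 [n1 hK]]] := @orbit_dichotomy R m A p mu W l Wsum WA WM l1
    (fun N => M N *m y) D D0 (MS y) (fun i => kap i < j.+1)%N (threshold j.+1) rho th0
    thr hfast hslow.
  exists c^-1; first by rewrite invr_gt0.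
  exists n1 => N n1N; rewrite mulrC ler_pdivlMr// mulrC.
  apply: le_trans (hc N n1N); have trho : t <= rho by rewrite le_max lexx.
  have rho0 : 0 < rho by apply: lt_le_trans trho.
  by rewrite ler_pM2l// lerXn2r ?nnegrE ?(ltW t0) ?(ltW rho0).
by exfalso; apply: nslow; exists K => //; exists n1 => N /hK[].
Qed.

Lemma slow_subspace j : subspace_pred (slow j).
Proof.
have th N : 0 <= threshold j ^+ N by rewrite exprn_ge0// threshold_ge0.
split=> [|a u v [K K0 [n0 hK]] [L L0 [n1 hL]]].
  by exists 1 => //; exists 0%N => N _; rewrite mulmx0 mxl1_0 mul1r.
exists (Normc.normc a * K + L); first by rewrite ltr_wpDl// mulr_ge0 ?normc_ge0 ?ltW.
exists (maxn n0 n1) => N; rewrite geq_max => /andP[/hK hu /hL hv].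
rewrite mulmxDr -scalemxAr mulrDl; apply: le_trans (mxl1D _ _) _; apply: lerD => //.
by rewrite mxl1Z -mulrA ler_wpM2l ?normc_ge0.
Qed.

Lemma slow_all y : slow 0 y.
Proof.
have hslow i : ~~ false -> Normc.normc (mu i) < threshold 0.
  move=> _; rewrite mur; have [->|ne] := eqVneq (kap i) ord0; first exact: threshold_gt.
  apply: (@lt_trans _ _ (r ord0)); last exact: threshold_gt.
  by apply: rdec; rewrite lt0n.
have th0 := threshold_gt0 (leq0n n).
have [[[i //]]|[K K0 [n1 hK]]] := @orbit_dichotomy R m A p mu W l Wsum WA WM l1
    (fun N => M N *m y) D D0 (MS y) (fun=> false) (threshold 0) (threshold 0 + 1) th0
    ltac:(lra) ltac:(done) hslow.
by exists K => //; exists n1 => N /hK[].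
Qed.

Lemma slow_decreasing j y : (j < n)%N -> slow j.+1 y -> slow j y.
Proof.
move=> jn [K K0 [n1 hK]]; exists K => //; exists n1 => N n1N.
apply: le_trans (hK N n1N) _; rewrite ler_pM2l// lerXn2r ?nnegrE ?threshold_ge0//.
have jn1 : (j < n.+1)%N by rewrite ltnW.
by apply/ltW/(lt_trans (@threshold_lt (Ordinal jn1) _ (ltnSn j) jn))/threshold_gt.
Qed.

(** The theorem for an arbitrary sequence of matrices [M] whose orbits are
    orbits of [A] up to a relative error [D * l ^- N]. *)
Lemma perron_splitting : exists Q : 'I_n.+1 -> 'M[R[i]]_m.+1,
  \sum_j Q j = 1%:M /\ forall j (x : 'cV[R[i]]_m.+1),
  let y := Q j *m x in y = 0 \/
  [/\ forall t, r j < t ->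
        lesssim (fun N => mxl1 (M N *m y)) (fun N => t ^+ N),
      forall t, 0 < t -> t < r j ->
        lesssim (fun N => t ^+ N) (fun N => mxl1 (M N *m y)),
      forall i, (kap i < j)%N ->
        lesssim (fun N => mxl1 (W i *m (M N *m y)))
                      (fun N => l ^- N * mxl1 (M N *m y))
    & forall i t, r (kap i) < t -> r j / l < t ->
        lesssim (fun N => mxl1 (W i *m (M N *m y))) (fun N => t ^+ N)].
Proof.
have [Q [Qsum hQ]] := flag_splitting slow_subspace slow_all slow_decreasing.
exists Q; split=> // j x y; have [sy nsy] := hQ j x.
have [->|/eqP y0] := eqVneq y 0; [by left|right].
have [up fst] := slow_upper sy.
have l0 : 0 < l by apply: lt_trans l1.
split=> //.
- move=> t t0 tr; have jn : (j < n)%N.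
    rewrite ltn_neqAle -ltnS ltn_ord andbT; apply/eqP => jn; move: tr.
    have -> : j = ord_max by exact: val_inj.
    by rewrite rmax ltNge ltW.
  by apply: (not_slow_lower jn _ t0 tr) => /(nsy jn).
- move=> i ij; have [K K0 [n0 hK]] := fst; exists K => //; exists n0 => N n0N.
  by rewrite mulrA hK.
- move=> i t kt; rewrite ltr_pdivrMr// => jt.
  have [K K0 [n0 hK]] := up _ jt.
  have tl0 : 0 < t * l by apply: le_lt_trans jt.
  have [||C C0 hC] := @component_growth R m A p mu W l WA WM l1 (fun N => M N *m y) D D0
    (MS y) i (t * l) t K n0 tl0 (ltW K0) _ _ hK.
  + by rewrite mulfK// gt_eqF.
  + by rewrite mur.
  by exists C => //; exists n0.
Qed.

End Splitting.

(** * The Fourier cocycle *)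

Section Cocycle.
Set Implicit Arguments.
Unset Strict Implicit.
Local Open Scope ring_scope.
Context {R : realType}.

(** Mean value theorem, on the segment between [0] and [t]. *)
Lemma lipschitz_at0 (f df : R -> R) (t : R) :
  (forall x : R, is_derive x 1 f (df x)) -> (forall x, `|df x| <= 1) ->
  `|f t - f 0| <= `|t|.
Proof.
move=> fdf df1.
have fc : forall a b, {within `[a, b], continuous f}%classic.
  move=> a b; apply: continuous_subspaceT => x.
  by apply: differentiable_continuous; apply/derivable1_diffP; have [] := fdf x.
have [t0|t0] := leP 0 t.
  have [c _ ->] := MVT_segment t0 (fun x _ => fdf x) (fc 0 t).
  by rewrite subr0 normrM ler_piMl.
have [c _ h] := MVT_segment (ltW t0) (fun x _ => fdf x) (fc t 0).
by rewrite distrC h sub0r normrM normrN ler_piMl.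
Qed.

Lemma cis_lipschitz (t : R) : Normc.normc (cis t - cis 0) <= 2 * `|t|.
Proof.
have -> : cis t - cis 0 = ((cos t - cos 0) +i* (sin t - sin 0))%C by [].
apply: le_trans (normc_le _ _) _; rewrite mulr_natl mulr2n; apply: lerD.
  apply: (@lipschitz_at0 cos (fun x => - sin x)) => x.
  by rewrite normrN sin_max.
by apply: (@lipschitz_at0 sin cos) => x; rewrite cos_max.
Qed.

Context {d ell : nat} (S : subst_rule R d ell).
Local Notation l := (scaling S).

Lemma fourier_mx_lipschitz (xi : 'rV[R]_d) :
  exists2 D, 0 <= D & forall a : R, 0 <= a ->
    mxl1 (fourier_mx S (a *: xi) - fourier_mx S 0) <= D * a.
Proof.
pose D (j k : 'I_ell) := `|l ^- d| * \sum_(x <- digits S j k) 2 * `|2 * pi * dotrv x xi|.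
exists (\sum_j \sum_k D j k).
  do 2!apply: sumr_ge0 => ? _; rewrite mulr_ge0//.
  by apply: sumr_ge0 => ? _; rewrite mulr_ge0.
move=> a a0; rewrite mulr_suml; apply: ler_sum => j _.
rewrite mulr_suml; apply: ler_sum => k _; rewrite !mxE -mulrBr Normc.normcM normc_real.
rewrite /D -mulrA ler_wpM2l// -sumrB mulr_suml; apply: le_trans (normc_sum _ _ _) _.
apply: ler_sum => x _.
have -> : dotrv x 0 = 0 by apply: big1 => i _; rewrite mxE mulr0.
have -> : dotrv x (a *: xi) = a * dotrv x xi.
  by rewrite /dotrv mulr_sumr; apply: eq_bigr => i _; rewrite mxE mulrCA.
rewrite mulr0; apply: le_trans (cis_lipschitz _) _.
by rewrite [2 * pi * (a * _)]mulrCA normrM (ger0_norm a0) [a * _]mulrC mulrA.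
Qed.

Lemma cocycleS N (xi : 'rV[R]_d) :
  cocycle S N.+1 xi = fourier_mx S (l ^- N *: xi) *m cocycle S N xi.
Proof. by rewrite /cocycle big_ord_recl /= subSS subn0. Qed.

Lemma cocycle_perturbation (xi : 'rV[R]_d) :
  exists2 D, 0 <= D & forall (y : 'cV[R[i]]_ell) N,
    mxl1 (cocycle S N.+1 xi *m y - fourier_mx S 0 *m (cocycle S N xi *m y)) <=
    D * l ^- N * mxl1 (cocycle S N xi *m y).
Proof.
have [D D0 hD] := fourier_mx_lipschitz xi; exists D => // y N.
rewrite cocycleS -mulmxA -mulmxBl; apply: le_trans (mxl1M _ _) _.
rewrite ler_wpM2r ?mxl1_ge0// hD// invr_ge0 exprn_ge0// ltW//.
exact: lt_trans (scaling_gt1 S).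
Qed.

End Cocycle.

(** * Lyapunov splitting of the cocycle *)

Theorem theorem6 (R : realType) (d ell : nat) (hd : (0 < d)%N)
    (hell : (0 < ell)%N) (S : subst_rule R d ell)
    (hprim : primitive S) (hstone : stone S)
    (nrm : 'cV[R[i]]_ell -> R) (hnrm : is_norm nrm)
    (n : nat) (chi : 'I_n.+1 -> \bar R)
    (hchi : log_moduli (fourier_mx S 0) chi)
    (P : 'I_n.+1 -> 'M[R[i]]_ell)
    (hP : spectral_projections (fourier_mx S 0) chi P) :
  exists2 r : R, 0 < r &
  forall xi : 'rV[R]_d, euclid xi <= r ->
  exists2 Q : 'I_n.+1 -> 'M[R[i]]_ell, \sum_j Q j = 1%:M &
  forall x : 'cV[R[i]]_ell,
    (forall j : 'I_n.+1,
       expapprox (fun N => nrm (cocycle S N xi *m (Q j *m x)))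
                 (fun N => expE (chi j * N%:R%:E)%E * nrm (Q j *m x))) /\
    (forall j k : 'I_n.+1,
       ((k < j)%N ->
        lesssim (fun N => nrm (P k *m (cocycle S N xi *m (Q j *m x))))
                (fun N => scaling S ^- N * nrm (cocycle S N xi *m (Q j *m x)))) /\
       ((j < k)%N ->
        lessapprox (fun N => nrm (P k *m (cocycle S N xi *m (Q j *m x))))
                   (fun N => Num.max (expE (chi k - chi j)%E) (scaling S)^-1 ^+ N *
                             nrm (cocycle S N xi *m (Q j *m x))))).
Proof.
clear hd hprim hstone.
case: ell => [//|m] in hell S nrm hnrm hchi P hP *.
(* The error [D * l ^- N] is eventually small whatever the size of xi, so any
   radius will do. *)
exists 1 => // xi _.
have [p [mu [W [kap [Wsum WA WM mur PW]]]]] := spectral_components hchi hP.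
have [D D0 hD] := cocycle_perturbation S xi.
have r0 j : 0 <= radius chi j by have [] := radius_spec hchi j.
have l1 := scaling_gt1 S; set l := scaling S in l1 hD *.
have l0 : 0 < l by apply: lt_trans l1.
have [Q [Qsum hQ]] := perron_splitting Wsum WA WM l1 mur r0 (radius_max hchi)
  (radius_decreasing hchi) D0 hD.
exists Q => // x.
have chiE j : chi j = lne (radius chi j)%:E by have [] := radius_spec hchi j.
have [K K0 hK] := nrm_le_mxl1 hnrm; have [L L0 hL] := mxl1_le_nrm hnrm hell.
have nrm_mxl1 (u : nat -> 'cV[R[i]]_m.+1) :
    lesssim (fun N => nrm (u N)) (fun N => mxl1 (u N)).
  by apply: (lesssim_all K0) => N.
have mxl1_nrm (u : nat -> 'cV[R[i]]_m.+1) :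
    lesssim (fun N => mxl1 (u N)) (fun N => nrm (u N)).
  by apply: (lesssim_all L0) => N.
have PWle (u : nat -> 'cV[R[i]]_m.+1) k : lesssim (fun N => nrm (P k *m u N))
    (fun N => \sum_(i | kap i == k) mxl1 (W i *m u N)).
  apply: lesssim_trans (nrm_mxl1 _) _; apply: (lesssim_all ltr01) => N.
  by rewrite mul1r PW mulmx_suml; exact: mxl1_sum.
(* Claim (i) for y <> 0: the limit exists and equals chi j on both sides. *)
have rates (j : 'I_n.+1) : Q j *m x <> 0 ->
    limn_esup (lograte (fun N => nrm (cocycle S N xi *m (Q j *m x)))) = chi j /\
    limn_einf (lograte (fun N => nrm (cocycle S N xi *m (Q j *m x)))) = chi j.
  move=> y0; have [//|[up low _ _]] := hQ j x; rewrite chiE; apply: lograte_exact => //.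
  - by move=> t /up; exact: lesssim_trans (nrm_mxl1 _).
  - by move=> t t0 /(low _ t0) h; exact: lesssim_trans h (mxl1_nrm _).
split=> [j|j k].
  have [y0|/eqP y0] := eqVneq (Q j *m x) 0.
    have -> : (fun N => nrm (cocycle S N xi *m (Q j *m x))) =
              (fun N => expE (chi j * N%:R%:E)%E * nrm (Q j *m x)).
      by apply/funext => N; rewrite y0 mulmx0 (nrm0 hnrm) mulr0.
    by split; rewrite /lessapprox /gtrapprox.
  have y1 : 0 < nrm (Q j *m x).
    by rewrite lt0r (nrm_ge0 hnrm) andbT; apply/eqP => /(norm_definite hnrm).
  have [up low] := rates j y0.
  pose g N := expE (chi j * N%:R%:E)%E * nrm (Q j *m x).
  have gE N : g N = nrm (Q j *m x) * radius chi j ^+ N.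
    by rewrite /g chiE expE_lneM// mulrC.
  have powle (a b : R) : 0 <= a -> a <= b ->
      lesssim (fun N => a ^+ N) (fun N => b ^+ N).
    move=> a0 ab; apply: (lesssim_all ltr01) => N.
    by rewrite mul1r lerXn2r ?nnegrE// (le_trans a0).
  have [gup glow] : limn_esup (lograte g) = chi j /\ limn_einf (lograte g) = chi j.
    rewrite [X in _ = X /\ _]chiE [X in _ /\ _ = X]chiE; apply: lograte_exact => //.
    - move=> t rt; apply: lesssim_trans (powle _ _ (r0 j) (ltW rt)).
      by apply: (lesssim_all y1) => N; rewrite gE.
    - move=> t t0 tr; apply: lesssim_trans (powle _ _ (ltW t0) (ltW tr)) _.
      apply: (lesssim_all (K := (nrm (Q j *m x))^-1)); first by rewrite invr_gt0.
      by move=> N; rewrite gE mulKf// gt_eqF.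
  by split; rewrite /lessapprox /gtrapprox -/g ?up ?gup ?low ?glow.
have [y0|/eqP y0] := eqVneq (Q j *m x) 0.
  have z N : nrm (P k *m (cocycle S N xi *m (Q j *m x))) = 0.
    by rewrite y0 !mulmx0 (nrm0 hnrm).
  have z' N : nrm (cocycle S N xi *m (Q j *m x)) = 0.
    by rewrite y0 !mulmx0 (nrm0 hnrm).
  split=> _.
    by exists 1 => //; exists 0%N => N _; rewrite z z' !mulr0.
  rewrite /lessapprox.
  rewrite (_ : (fun N => nrm (P k *m _)) = fun=> 0); last exact/funext.
  rewrite (_ : (fun N => _ * nrm (cocycle S N xi *m (Q j *m x))) = fun=> 0)//.
  by apply/funext => N; rewrite z' mulr0.
have [//|[up low fst snd]] := hQ j x.
split=> [kj|jk].
  apply: lesssim_trans (PWle _ k) _.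
  apply: (@lesssim_trans _ _ (fun N => l ^- N * mxl1 (cocycle S N xi *m (Q j *m x)))).
    apply: lesssim_sum => [N|i /eqP ik].
      by rewrite mulr_ge0 ?mxl1_ge0// invr_ge0 exprn_ge0// ltW.
    by apply: fst; rewrite ik.
  apply: lesssim_mull; last exact: mxl1_nrm.
  by move=> N; rewrite invr_ge0 exprn_ge0// ltW.
have rj0 : 0 < radius chi j by apply: le_lt_trans (r0 k) (radius_decreasing hchi jk).
have -> : expE (chi k - chi j)%E = radius chi k / radius chi j.
  by rewrite !chiE expE_lneB.
set B := Num.max _ _.
have B0 : 0 < B by rewrite lt_max invr_gt0 l0 orbT.
have Brj0 : 0 <= B * radius chi j by rewrite mulr_ge0 ?ltW.
rewrite /lessapprox.
(* Both sides are compared with [B r_j = max (r_k, r_j / lambda)]: the right-hand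
   side grows at least at this rate because the orbit itself has the exact rate
   r_j. *)
apply: (@le_trans _ _ (lne (B * radius chi j)%:E)).
  apply: lograte_le => // t Bt.
  apply: lesssim_trans (PWle _ k) _.
  have t0 : 0 <= t by apply: le_trans Brj0 (ltW Bt).
  apply: lesssim_sum => [N|i /eqP ik]; first exact: exprn_ge0.
  apply: snd; apply: le_lt_trans Bt.
    by rewrite ik -ler_pdivrMr// le_max lexx.
  by rewrite mulrC ler_pM2r// le_max lexx orbT.
apply: le_trans (limn_einf_sup _).
apply: lograte_ge => // t t0 tB.
have tB0 : 0 < t / B by rewrite divr_gt0.
have := low (t / B) tB0; rewrite ltr_pdivrMr// mulrC => /(_ tB) h.
have {}h := lesssim_trans h (mxl1_nrm _).
have := lesssim_mull (c := fun N => B ^+ N) (fun N => exprn_ge0 N (ltW B0)) h.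
have -> // : (fun N => B ^+ N * (t / B) ^+ N) = (fun N => t ^+ N).
apply/funext => N; rewrite -exprMn; congr (_ ^+ _).
by rewrite mulrC divfK// gt_eqF.
Qed.
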